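(* Let $k\in\mathbb R$ and $\mathring h(r)=e^r+ke^{-r}$; let $a$ be the zero of $\mathring h$ if $\mathring h$ vanishes somewhere, and $a=-\infty$ if $\mathring h$ never vanishes. Let $M=(a,+\infty)\times N$ carry the metrics $g_0=dr^2+\mathring h^2(r)\hat G$ and $g=dr^2+G(r)$ described in the context. If the limits $\mathcal M(a)$ and $\mathcal M(+\infty)$ of the relative radial mass $\mathcal M(r)$ at $a$ and $+\infty$ exist (as real numbers) and $\mathring{h}^{2}(R_{rr}+(n-1))\in L^1(M,dr\,d\mu_{\hat{G}})$, then $$\mathcal M(+\infty)-\mathcal M(a)\ \geq\ \int_M\mathring{h}^{2}\big(R_{rr}+(n-1)\big)\,dr\,d\mu_{\hat{G}},$$ with equality if and only if $g$ is a warped product in the sense that $G(r)=\mathring{h}^2(r)\widetilde{G}$ for some fixed (independent of $r$) Riemannian metric $\widetilde{G}$ on $N$. Moreover, if $g$ is asymptotic to $g_0$ at some $r_0\in[a,+\infty]$, then equality occurs if and only if $g=g_0$.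
   Context: Let $n\geq 2$, let $N$ be a compact $(n-1)$-dimensional smooth manifold (with or without boundary), and let $r$ be the coordinate on the interval factor of $M$. All objects are assumed $C^\infty$. $\hat{G}$ is a fixed Riemannian metric on $N$, with Riemannian measure $\mu_{\hat G}$; $\mathring G(r)=\mathring h^2(r)\hat G$; and $G(r)$ is a family of Riemannian metrics on $N$, so that $g=dr^2+G(r)$ is a Riemannian metric on $M$. Let $H$ and $\mathring H$ be the mean curvatures (traces of the Weingarten maps with respect to $\partial_r$) of $N(r)=\{r\}\times N$ relative to $g$ and $g_0$: $H=\frac12\operatorname{Tr}(G^{-1}\partial_rG)$ and $\mathring H=(n-1)\mathring h'/\mathring h$. The relative radial mass is $\mathcal M(r)=\int_N \mathring{h}^{2}(\mathring{H}-H)\,d\mu_{\hat G}$. $R_{rr}$ denotes the Ricci curvature of $g$ in the $(\partial_r,\partial_r)$ direction. $g$ is said to be asymptotic to $g_0$ at a point $r_0$ of the closure (in $[-\infty,+\infty]$) of the interval if $\|G-\mathring G\|_{\mathring G}=o(1)$ as $r\to r_0$, uniformly on $N$ (pointwise norm of tensors on $N$ with respect to $\mathring G(r)$); for $r_0$ in the open interval this means that the two metrics coincide on $N(r_0)$. *)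

(* Defs.v *)
From HB Require Import structures.
From mathcomp Require Import all_boot all_order all_algebra.
From mathcomp Require Import all_classical all_reals all_analysis.
Set Implicit Arguments.
Unset Strict Implicit.
Unset Printing Implicit Defensive.
Import Order.TTheory GRing.Theory Num.Theory numFieldNormedType.Exports.
Local Open Scope classical_set_scope.
Local Open Scope ring_scope.

Section calculus.
Variables (R : realType) (m : nat).
Implicit Types (S V : set 'rV[R]_m) (f : 'rV[R]_m -> R).

Definition basis_vec (i : 'I_m) : 'rV[R]_m := delta_mx 0 i.

Definition iter_partial f (s : seq 'I_m) : 'rV[R]_m -> R :=
  foldr (fun i g => fun x => 'D_(basis_vec i) g x) f s.

(* C^oo on an open set: all iterated partial derivatives exist and are
   continuous there. *)
Definition Cinfty V f := forall (s : seq 'I_m) (x : 'rV[R]_m), V x ->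
  {for x, continuous (iter_partial f s)} /\
  forall i, derivable (iter_partial f s) x (basis_vec i).

(* C^oo on an arbitrary subset S of R^m: locally the restriction to S of a C^oo
   function defined on an open subset of R^m (this is what is needed at the
   boundary of a half-space). *)
Definition smooth_on S f := forall x, S x ->
  exists V F, [/\ open V, V x, Cinfty V F & {in V `&` S, f =1 F}].

(* Partial derivative along S: the increments are restricted to those staying
   in S, hence it is one-sided at a boundary point when the direction is
   transverse to the boundary. *)
Definition partial S (i : 'I_m) f (x : 'rV[R]_m) : R :=
  lim ((fun t : R => t^-1 * (f (x + t *: basis_vec i) - f x))
         @ within [set t | S (x + t *: basis_vec i)] 0^').

(* g is the matrix of a metric in coordinates ranging over S;
   christoffel S g k i j is the symbol with upper index k. *)
Definition christoffel S (g : 'rV[R]_m -> 'M[R]_m) (k i j : 'I_m)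
    (x : 'rV[R]_m) : R :=
  2^-1 * \sum_l invmx (g x) k l *
    (partial S i (fun y => g y j l) x + partial S j (fun y => g y i l) x
     - partial S l (fun y => g y i j) x).

(* Sign convention: the unit sphere has positive Ricci curvature. *)
Definition ricci S (g : 'rV[R]_m -> 'M[R]_m) (j k : 'I_m) (x : 'rV[R]_m) : R :=
  let Gam := christoffel S g in
  \sum_i (partial S i (Gam i j k) x - partial S k (Gam i j i) x)
  + \sum_i \sum_l (Gam i i l x * Gam l j k x - Gam i k l x * Gam l j i x).

End calculus.

(* Lebesgue integral over R^d of a nonnegative Borel function, as an iterated
   integral. *)
Fixpoint iter_integral (R : realType) (d : nat) :
    ('rV[R]_d -> \bar R) -> \bar R :=
  match d with
  | 0 => fun f => f 0
  | d'.+1 => fun f =>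
      (\int[@lebesgue_measure R]_(t in [set: R])
         iter_integral (fun y : 'rV[R]_d' => f (row_mx (const_mx t : 'rV[R]_1) y)))%E
  end.

(* {x in R^d | x_0 >= 0}. *)
Definition half_space (R : realType) (d : nat) : set 'rV[R]_d :=
  [set x | forall i : 'I_d, i = 0%N :> nat -> 0 <= x 0 i].

(* Homeomorphism from an open set of N to a relatively open set of the
   half-space; both interior and boundary charts are of this form. *)
Record chart (R : realType) (d : nat) (N : ptopologicalType) := Chart {
  cdom : set N;
  cmap : N -> 'rV[R]_d;
  cinv : 'rV[R]_d -> N;
  cdom_open : open cdom;
  cmap_image : exists2 V : set 'rV[R]_d,
    open V & cmap @` cdom = V `&` @half_space R d;
  cmapK : {in cdom, cancel cmap cinv};
  cmap_continuous : {within cdom, continuous cmap};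
  cinv_continuous : {within cmap @` cdom, continuous cinv} }.

(* Smooth manifold of dimension d, with or without boundary. The library's
   measurable types are pointed, hence so is the underlying space. *)
Record smooth_manifold (R : realType) (d : nat) (N : ptopologicalType) :=
SmoothManifold {
  atlas : Type;
  chart_of :> atlas -> chart R d N;
  chart_at : N -> atlas;
  chart_atP : forall p, cdom (chart_of (chart_at p)) p;
  transition_smooth : forall i j (b : 'I_d),
    smooth_on (cmap (chart_of i) @` (cdom (chart_of i) `&` cdom (chart_of j)))
      (fun x => cmap (chart_of j) (cinv (chart_of i) x) 0 b);
  manifold_hausdorff : hausdorff_space N;
  manifold_second_countable : @second_countable N }.

Definition borel (N : ptopologicalType) := g_sigma_algebraType (@open N).

Section manifold.
Variables (R : realType) (d : nat) (N : ptopologicalType).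
Variable X : smooth_manifold R d N.

(* Covariant 2-tensors on N, given by their matrices in all the charts; the
   value T i p is relevant only for p in the domain of i. *)
Definition tensor := atlas X -> N -> 'M[R]_d.

Definition tensor_eq (S T : tensor) :=
  forall i p, cdom (X i) p -> S i p = T i p.

Definition chart_range (i : atlas X) : set 'rV[R]_d := cmap (X i) @` cdom (X i).

(* Entry (a, b) is the derivative of the a-th coordinate of chart j along the
   b-th coordinate of chart i. *)
Definition transition_jacobian (i j : atlas X) (p : N) : 'M[R]_d :=
  \matrix_(a, b) partial (cmap (X i) @` (cdom (X i) `&` cdom (X j))) b
    (fun x => cmap (X j) (cinv (X i) x) 0 a) (cmap (X i) p).

Record riemannian_metric (g : tensor) : Prop := RiemannianMetric {
  metric_compat : forall i j p, cdom (X i) p -> cdom (X j) p ->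
    g i p = (transition_jacobian i j p)^T *m g j p *m transition_jacobian i j p;
  metric_sym : forall i p, cdom (X i) p -> (g i p)^T = g i p;
  metric_pos : forall i p (v : 'rV[R]_d), cdom (X i) p -> v != 0 ->
    0 < (v *m g i p *m v^T) 0 0;
  metric_smooth : forall i a b,
    smooth_on (chart_range i) (fun x => g i (cinv (X i) x) a b) }.

(* The Borel measure with density sqrt (det g) in every chart. *)
Definition riemannian_measure (g : tensor) (mu : set (borel N) -> \bar R) :=
  forall i (A : set (borel N)), measurable A -> A `<=` cdom (X i) ->
    mu A = iter_integral (fun x : 'rV[R]_d =>
      (\1_(cmap (X i) @` A) x * Num.sqrt (\det (g i (cinv (X i) x))))%:E).

(* Pointwise norm of T with respect to g. *)
Definition tensor_norm (g T : tensor) (p : N) : R :=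
  let i := chart_at X p in
  Num.sqrt (\tr (invmx (g i p) *m T i p *m invmx (g i p) *m (T i p)^T)).

Definition tensor_sub (S T : tensor) : tensor := fun i p => S i p - T i p.

Definition warped (h : R -> R) (g : tensor) (r : R) : tensor :=
  fun i p => h r ^+ 2 *: g i p.

(* In the product chart (r, x), with r the 0-th coordinate, ]a, +oo[ x N has
   coordinates ranging over cyl_range, and dr^2 + G(r) has matrix cyl_metric. *)
Definition cyl_range (a : \bar R) (i : atlas X) : set 'rV[R]_(1 + d) :=
  [set z | (a < (lsubmx z 0 0)%:E)%E /\ chart_range i (rsubmx z)].

Definition cyl_metric (G : R -> tensor) (i : atlas X) (z : 'rV[R]_(1 + d)) :
    'M[R]_(1 + d) :=
  block_mx 1%:M 0 0 (G (lsubmx z 0 0) i (cinv (X i) (rsubmx z))).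

Definition cyl_metric_eq (a : \bar R) (G1 G2 : R -> tensor) :=
  forall i z, cyl_range a i z -> cyl_metric G1 i z = cyl_metric G2 i z.

(* dr^2 + G(r) is a (smooth) Riemannian metric on ]a, +oo[ x N. *)
Definition metric_family (a : \bar R) (G : R -> tensor) :=
  (forall r, (a < r%:E)%E -> riemannian_metric (G r)) /\
  (forall i b c, smooth_on (cyl_range a i) (fun z => cyl_metric G i z b c)).

(* Ricci curvature of dr^2 + G(r) in the direction (d/dr, d/dr). *)
Definition ricci_rr (a : \bar R) (G : R -> tensor) (r : R) (p : N) : R :=
  let i := chart_at X p in
  ricci (cyl_range a i) (cyl_metric G i) 0 0
    (row_mx (const_mx r : 'rV[R]_1) (cmap (X i) p)).

Definition mean_curvature (G : R -> tensor) (r : R) (p : N) : R :=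
  let i := chart_at X p in
  2^-1 * \tr (invmx (G r i p)
              *m \matrix_(b, c) derive1 (fun s => G s i p b c) r).

Definition mean_curvature0 (h : R -> R) (r : R) : R :=
  d%:R * derive1 h r / h r.

Definition radial_mass (mu : {measure set (borel N) -> \bar R}) (h : R -> R)
    (G : R -> tensor) (r : R) : R :=
  \int[mu]_(p in [set: borel N])
    (h r ^+ 2 * (mean_curvature0 h r - mean_curvature G r p)).

(* r -> r0 inside ]a, +oo[; the value r = r0 is not excluded. *)
Definition approach (a r0 : \bar R) : set_system R :=
  within [set r | (a < r%:E)%E]
    match r0 with
    | x%:E => nbhs x
    | +oo => pinfty_nbhs R
    | -oo => ninfty_nbhs R
    end%E.

Definition asymptotic_at (a r0 : \bar R) (h : R -> R) (ghat : tensor)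
    (G : R -> tensor) :=
  forall e : R, 0 < e -> \forall r \near approach a r0, forall p,
    tensor_norm (warped h ghat r) (tensor_sub (G r) (warped h ghat r)) p < e.

End manifold.

Definition hring (R : realType) (k r : R) : R := expR r + k * expR (- r).

(* For every k the function hring k has at most one zero. *)
Definition left_end (R : realType) (k : R) (a : \bar R) :=
  (exists2 x, hring k x = 0 & a = x%:E) \/
  ((forall x, hring k x != 0) /\ a = -oo%E).

(* Main.v *)
Require Import Defs.
From HB Require Import structures.
From mathcomp Require Import all_boot all_order all_algebra.
From mathcomp Require Import all_classical all_reals all_analysis.
From mathcomp Require Import measurable_realfun ring lra.
Import Order.TTheory GRing.Theory Num.Theory numFieldNormedType.Exports.
Local Open Scope classical_set_scope.
Local Open Scope ring_scope.

(** The slices [{r} * N] have Weingarten map [W = G^-1 G' / 2] and mean curvature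
    [H = tr W], and the metric [dr^2 + G(r)] has geodesic radial lines. The trace
    of the Riccati equation then reads [R_rr = - H' - tr (W^2)] ([ricci_cyl]). Put
    [d = n - 1]. The function [h(r) = e^r + k e^(-r)] satisfies [h'' = h], hence
    the integrand [d h h' - h^2 H] of the relative radial mass has derivative
<<
      h^2 (R_rr + d) + d h'^2 - 2 h h' H + h^2 tr (W^2)
        = h^2 (R_rr + d) + |h' - h W|^2
>>
    ([dr_mass_density]). The last term, the defect, is the squared norm of a
    symmetric endomorphism, so it is nonnegative ([sqnorm_ge0]).

    Integrate over [N]: the mass [M] has derivative [F + Q], where [F(r)] is the
    integral over [N] of the Ricci term and [Q(r) >= 0] that of the defect. Then
    [M(r)] minus the integral of [F] from [a] to [r] is nondecreasing; comparison
    of its limits at the two ends gives the inequality, with equality exactly when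
    [Q] vanishes identically ([monotone_defect]). By Fubini's theorem the integral
    of [F] is the integral of the Ricci term over the cylinder. Differentiation
    under the integral sign is legitimate since [N] is compact, of finite measure
    ([measure_finite]), and since the integrands are continuous on the product, up
    to the boundary.

    As the Riemannian measure charges every nonempty open set
    ([measure_open_gt0]), [Q = 0] means that the defect is zero everywhere, i.e.
    [h W = h'], i.e. [(G / h^2)' = 0]: the metric is warped
    ([warped_of_defect0], [defect0_of_warped]). If moreover [g] is asymptotic to
    [g_0] somewhere, then [G / h^2], being constant in [r], must be [Ghat]
    ([asymptotic_unique]).

    Two points need care. The curvatures are defined through a chart chosen at
    each point; since the changes of charts do not depend on [r], all of them
    transform tensorially and the choice is immaterial ([radial_compat]). At the
    boundary of [N] the tangential derivatives are one-sided, but the components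
    that they act upon are constant ([partial_metric_row0]). *)

Set Implicit Arguments.
Unset Strict Implicit.
Unset Printing Implicit Defensive.

(** * Positive definite forms *)

Definition posdef (R : realType) (d : nat) (A : 'M[R]_d) :=
  A^T = A /\ forall v : 'rV[R]_d, v != 0 -> 0 < (v *m A *m v^T) 0 0.

Section LinearAlgebra.
Variable R : realType.

(** Induction on the size: the Schur complement of the upper left entry [al] is
    again positive definite, as one sees by testing the form on the vectors
    [(- w b^T / al, w)], which are orthogonal to the first basis vector. *)
Lemma cholesky (d : nat) (A : 'M[R]_d) :
  posdef A -> exists2 P : 'M[R]_d, P \in unitmx & A = P *m P^T.
Proof.
elim: d A => [|d IH] A [Asym Apos].
  by exists 1%:M; [exact: unitmx1 | apply/matrixP => -[]].
rewrite -[d.+1]/(1 + d)%N in A Asym Apos *.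
pose al := A 0 0.
pose b := ursubmx A; pose D := drsubmx A.
have Aul : ulsubmx A = al%:M.
  apply/matrixP => i j; rewrite (ord1 i) (ord1 j) !mxE /= mulr1n.
  by congr (A _ _); apply/val_inj.
have Adl : dlsubmx A = b^T by rewrite /b trmx_ursub Asym.
have Dsym : D^T = D by rewrite /D trmx_drsub Asym.
have AE : A = block_mx al%:M b b^T D by rewrite -[LHS]submxK Aul Adl.
have al_gt0 : 0 < al.
  have /Apos : row_mx 1%:M 0 != 0 :> 'rV[R]_(1 + d).
    apply/eqP => /(congr1 lsubmx); rewrite row_mxKl linear0 => /matrixP/(_ 0 0).
    by rewrite !mxE /= => /eqP; rewrite oner_eq0.
  rewrite AE mul_row_block tr_row_mx mul_row_col.
  by rewrite !mul1mx !mul0mx !addr0 trmx1 mulmx1 trmx0 mulmx0 addr0 mxE mulr1n.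
pose S := D - al^-1 *: (b^T *m b).
have [|P Pu SE] := IH S.
  split.
    by rewrite /S linearB /= linearZ /= trmx_mul trmxK Dsym.
  move=> w w0.
  have /Apos : row_mx (- al^-1 *: (w *m b^T)) w != 0 :> 'rV[R]_(1 + d).
    apply: contraNneq w0 => /(congr1 rsubmx).
    by rewrite row_mxKr linear0 => ->.
  rewrite AE mul_row_block tr_row_mx mul_row_col mul_mx_scalar scalerA.
  rewrite mulrN divff ?gt_eqF // scaleN1r addNr mul0mx add0r.
  suff -> : - al^-1 *: (w *m b^T) *m b + w *m D = w *m S by [].
  by rewrite /S mulmxBr -scalemxAr -scalemxAl mulmxA scaleNr addrC.
pose s := Num.sqrt al.
have s0 : s != 0 by rewrite sqrtr_eq0 -ltNge.
have ss : s * s = al by rewrite -expr2 sqr_sqrtr // ltW.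
exists (block_mx s%:M 0 (s^-1 *: b^T) P).
  by rewrite unitmxE det_lblock det_scalar expr1 unitrM unitfE s0 -unitmxE.
rewrite tr_block_mx mulmx_block tr_scalar_mx !trmx0 !mulmx0 !mul0mx !addr0.
rewrite AE !mul_scalar_mx mul_mx_scalar scale_scalar_mx linearZ /= trmxK ss.
rewrite !scalerA mulfV // !scale1r -SE /S -scalemxAl -scalemxAr scalerA -invfM ss.
by rewrite addrC subrK.
Qed.

Lemma posdef_det_gt0 (d : nat) (A : 'M[R]_d) : posdef A -> 0 < \det A.
Proof.
move=> /cholesky[P Pu ->]; rewrite det_mulmx det_tr -expr2 exprn_even_gt0 //=.
by rewrite -unitfE -unitmxE.
Qed.

Lemma posdef_unit (d : nat) (A : 'M[R]_d) : posdef A -> A \in unitmx.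
Proof. by move=> /posdef_det_gt0 A0; rewrite unitmxE unitfE gt_eqF. Qed.

Lemma invmx_unique (d : nat) (A X : 'M[R]_d) : A \in unitmx ->
  A *m X = 1%:M -> invmx A = X.
Proof. by move=> Au AX; rewrite -[X](mulKmx Au) AX mulmx1. Qed.

(** The squared norm, for the scalar product [A], of the bilinear form [T]: both
    indices of one copy of [T] are raised. *)
Definition sqnorm (d : nat) (A T : 'M[R]_d) :=
  \tr (invmx A *m T *m invmx A *m T^T).

(** In a basis which is orthonormal for [A] the norm is the Frobenius norm. *)
Lemma sqnormE (d : nat) (A T : 'M[R]_d) : posdef A ->
  exists2 P : 'M[R]_d, P \in unitmx &
    sqnorm A T = \sum_i \sum_j (P *m T *m P^T) i j ^+ 2.
Proof.
move=> /cholesky[P Pu AE]; exists (invmx P); first by rewrite unitmx_inv.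
set S := _ *m _ *m _.
have -> : sqnorm A T = \tr (S *m S^T).
  rewrite /sqnorm; have -> : invmx A = (invmx P)^T *m invmx P.
    have Au : A \in unitmx by rewrite AE unitmx_mul unitmx_tr Pu.
    apply: (invmx_unique Au); rewrite AE -!mulmxA (mulmxA P^T) -trmx_mul.
    by rewrite mulVmx // trmx1 mul1mx mulmxV.
  rewrite /S !trmx_mul trmxK -!mulmxA mxtrace_mulC -!mulmxA.
  by rewrite !mulmxA.
rewrite /mxtrace; apply: eq_bigr => i _; rewrite mxE; apply: eq_bigr => j _.
by rewrite [S^T _ _]mxE expr2.
Qed.

Lemma sqnorm_ge0 (d : nat) (A T : 'M[R]_d) : posdef A -> 0 <= sqnorm A T.
Proof.
move=> /(sqnormE T)[P _ ->].
by apply: sumr_ge0 => i _; apply: sumr_ge0 => j _; exact: sqr_ge0.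
Qed.

Lemma sqnorm_eq0 (d : nat) (A T : 'M[R]_d) : posdef A ->
  sqnorm A T = 0 -> T = 0.
Proof.
move=> /(sqnormE T)[P Pu ->] /psumr_eq0P S0.
have {}S0 : P *m T *m P^T = 0.
  apply/matrixP => i j; rewrite [RHS]mxE; apply/eqP; rewrite -sqrf_eq0; apply/eqP.
  have Si0 : \sum_k (P *m T *m P^T) i k ^+ 2 = 0.
    by apply: S0 => // k _; apply: sumr_ge0 => l _; exact: sqr_ge0.
  by apply: (psumr_eq0P _ Si0) => // k _; exact: sqr_ge0.
have PTu : P^T \in unitmx by rewrite unitmx_tr.
by rewrite -[T](mulKmx Pu) -[P *m T](mulmxK PTu) S0 mul0mx mulmx0.
Qed.

(** The transformation law of a metric forces the matrix [J] of the change of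
    coordinates to be invertible, because both sides have rank [d]. Raising one
    index therefore turns congruence by [J] into conjugation by [J], and the
    traces of such endomorphisms do not depend on the chart. *)
Lemma congruence_invmx (d : nat) (A B J : 'M[R]_d) : A \in unitmx ->
  A = J^T *m B *m J -> [/\ J \in unitmx, B \in unitmx &
  forall T, invmx A *m (J^T *m T *m J) = invmx J *m (invmx B *m T) *m J].
Proof.
move=> Au AE.
have /andP[/andP[JTu Bu] Ju] : (J^T \in unitmx) && (B \in unitmx) && (J \in unitmx).
  by rewrite -!unitmx_mul -AE.
split=> // T.
rewrite -[RHS]mul1mx -(mulVmx Au) {3}AE -!mulmxA; congr (_ *m (_ *m _)).
by rewrite (mulmxA J) mulmxV // mul1mx (mulmxA B) mulmxV // mul1mx.
Qed.

Lemma congruence_trace (d : nat) (A B J T : 'M[R]_d) : A \in unitmx ->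
  A = J^T *m B *m J -> \tr (invmx A *m (J^T *m T *m J)) = \tr (invmx B *m T).
Proof.
move=> Au AE; have [Ju Bu ->] := congruence_invmx Au AE.
by rewrite -mulmxA mxtrace_mulC -!mulmxA mulmxV // mulmx1.
Qed.

Lemma congruence_trace2 (d : nat) (A B J T U : 'M[R]_d) : A \in unitmx ->
  A = J^T *m B *m J ->
  \tr (invmx A *m (J^T *m T *m J) *m (invmx A *m (J^T *m U *m J))) =
  \tr (invmx B *m T *m (invmx B *m U)).
Proof.
move=> Au AE; have [Ju Bu E] := congruence_invmx Au AE.
rewrite !E -!mulmxA mulKVmx // mxtrace_mulC -!mulmxA mulmxV // mulmx1.
by [].
Qed.

(** For [A' = dA/dr] the endomorphism [W = A^-1 A' / 2] is the Weingarten map; the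
    left-hand side is the squared norm of [u - v W], and the two traces on the
    right are its mean curvature [tr W] and [tr (W^2)]. *)
Lemma sqnorm_conformal (d : nat) (A A' : 'M[R]_d) (u v : R) : posdef A ->
  A'^T = A' ->
  sqnorm A (u *: A - (v / 2) *: A') =
    d%:R * u ^+ 2 - 2 * u * v * (2^-1 * \tr (invmx A *m A'))
    + v ^+ 2 * (4^-1 * \tr (invmx A *m A' *m (invmx A *m A'))).
Proof.
move=> Ap A's; have Au := posdef_unit Ap.
have sE T : T^T = T -> sqnorm A T = \tr (invmx A *m T *m (invmx A *m T)).
  by move=> Ts; rewrite /sqnorm Ts -!mulmxA.
rewrite sE; last first.
  by apply/matrixP => i j; rewrite !mxE -[in LHS]Ap.1 -[in LHS]A's !mxE.
have -> : invmx A *m (u *: A - (v / 2) *: A') = u%:M - (v / 2) *: (invmx A *m A').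
  by rewrite mulmxBr -!scalemxAr mulVmx // scalemx1.
move: (invmx A *m A') => W; set c := v / 2.
have -> : (u%:M - c *: W) *m (u%:M - c *: W) =
    (u ^+ 2)%:M + ((- (2 * u * c)) *: W + (c ^+ 2) *: (W *m W)).
  rewrite mulmxBl 2!mulmxBr 2!mul_scalar_mx -!scalemxAl mul_mx_scalar.
  rewrite -scalemxAr; move: (W *m W) => V.
  by apply/matrixP => i j; rewrite !mxE; case: (i == j); rewrite ?mulr1n ?mulr0n; ring.
rewrite mxtraceD [X in _ + X]mxtraceD 2!mxtraceZ mxtrace_scalar -[u ^+ 2 *+ d]mulr_natl.
by rewrite /c; field.
Qed.

End LinearAlgebra.

(** * Functions which are continuously differentiable in r *)

Section FunctionClass.
Variables (R : realType) (T : Type) (U : set T).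

(** Continuity and continuous differentiability in [r] pass to determinants,
    inverse matrices and traces for the same reason, stability under the field
    operations; this record factors the argument. *)
Record function_class (P : (T -> R) -> Prop) : Prop := FunctionClass {
  class_eq : forall f g, (forall z, U z -> f z = g z) -> P f -> P g;
  class_cst : forall c, P (fun=> c);
  class_add : forall f g, P f -> P g -> P (fun z => f z + g z);
  class_mul : forall f g, P f -> P g -> P (fun z => f z * g z);
  class_inv : forall f, (forall z, U z -> f z != 0) -> P f ->
    P (fun z => (f z)^-1) }.

Variables (P : (T -> R) -> Prop) (PC : function_class P).

Lemma class_scale c f : P f -> P (fun z => c * f z).
Proof. by move=> Pf; apply: (class_mul PC) => //; exact: class_cst. Qed.

Lemma class_sub f g : P f -> P g -> P (fun z => f z - g z).
Proof.
move=> Pf Pg; apply: (class_eq PC (f := fun z => f z + -1 * g z)).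
  by move=> z _; rewrite mulN1r.
by apply: (class_add PC) => //; exact: class_scale.
Qed.

Lemma class_sum (I : Type) (s : seq I) (f : I -> T -> R) :
  (forall i, P (f i)) -> P (fun z => \sum_(i <- s) f i z).
Proof.
move=> Pf; elim: s => [|i s IH].
  by apply: class_eq (class_cst PC 0) => // z _; rewrite big_nil.
apply: class_eq (class_add PC (Pf i) IH) => // z _.
by rewrite big_cons.
Qed.

Lemma class_prod (I : Type) (s : seq I) (f : I -> T -> R) :
  (forall i, P (f i)) -> P (fun z => \prod_(i <- s) f i z).
Proof.
move=> Pf; elim: s => [|i s IH].
  by apply: class_eq (class_cst PC 1) => // z _; rewrite big_nil.
apply: class_eq (class_mul PC (Pf i) IH) => // z _.
by rewrite big_cons.
Qed.

Definition class_mx m n (A : T -> 'M[R]_(m, n)) :=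
  forall i j, P (fun z => A z i j).

Lemma class_det n (A : T -> 'M[R]_n) : class_mx A -> P (fun z => \det (A z)).
Proof.
move=> PA; apply: class_sum => s.
by apply: class_scale; apply: class_prod => i; exact: PA.
Qed.

Lemma class_mulmx m n p (A : T -> 'M[R]_(m, n)) (B : T -> 'M[R]_(n, p)) :
  class_mx A -> class_mx B -> class_mx (fun z => A z *m B z).
Proof.
move=> PA PB i j; apply: (class_eq PC (f := fun z => \sum_k A z i k * B z k j)).
  by move=> z _; rewrite mxE.
by apply: class_sum => k; exact: class_mul.
Qed.

Lemma class_trace n (A : T -> 'M[R]_n) : class_mx A -> P (fun z => \tr (A z)).
Proof. by move=> PA; apply: class_sum => i; exact: PA. Qed.

Lemma class_invmx n (A : T -> 'M[R]_n) : (forall z, U z -> A z \in unitmx) ->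
  class_mx A -> class_mx (fun z => invmx (A z)).
Proof.
move=> Au PA i j.
apply: (class_eq PC (f := fun z => (\det (A z))^-1 * \adj (A z) i j)).
  by move=> z Uz; rewrite /invmx (Au _ Uz) [RHS]mxE.
apply: (class_mul PC).
  apply: (class_inv PC); last exact: class_det.
  by move=> z /Au; rewrite unitmxE unitfE.
apply: (class_eq PC
  (f := fun z => (-1) ^+ (j + i) * \det (row' j (col' i (A z))))).
  by move=> z _; rewrite mxE.
apply: class_scale; apply: class_det => k l.
by apply: class_eq (PA (lift j k) (lift i l)) => // z _; rewrite !mxE.
Qed.

End FunctionClass.

Section Continuity.
Variables (R : realType) (T : topologicalType) (U : set T).

Definition C0 (f : T -> R) := forall z, U z -> continuous_at z f.

Lemma C0_class : open U -> function_class U C0.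
Proof.
move=> oU; split.
- move=> f g fg Cf z Uz; rewrite /continuous_at -(fg z Uz).
  apply: cvg_trans (Cf z Uz); apply: near_eq_cvg.
  by apply: filterS (open_nbhs_nbhs (conj oU Uz)) => y /fg.
- by move=> c z _; exact: cvg_cst.
- by move=> f g Cf Cg z Uz; apply: continuousD; [exact: Cf|exact: Cg].
- by move=> f g Cf Cg z Uz; apply: continuousM; [exact: Cf|exact: Cg].
- by move=> f f0 Cf z Uz; apply: continuousV; [exact: f0|exact: Cf].
Qed.

End Continuity.

Section RadialDerivative.
Variables (R : realType) (N : topologicalType) (U : set (R * N)).
Hypothesis oU : open U.

Definition dr (f : R * N -> R) : R * N -> R :=
  fun z => derive1 (fun s => f (s, z.2)) z.1.

(** The regularity which allows one differentiation in [r] under the integral sign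
    over [N]. *)
Definition C1 (f : R * N -> R) := [/\
  forall z, U z -> derivable (fun s => f (s, z.2)) z.1 1, C0 U f & C0 U (dr f)].

Lemma near_slice z : U z -> \forall s \near z.1, U (s, z.2).
Proof.
move: z => [r p] Uz /=.
have : continuous_at r (fun s : R => (s, p)) by apply: (@cvg_pair _ _ _ _ (nbhs r) (nbhs p)); [exact: cvg_id|exact: cvg_cst].
by apply; exact: open_nbhs_nbhs.
Qed.

Lemma C1_class : function_class U C1.
Proof.
have C0U := @C0_class R _ _ oU.
have isd f : C1 f -> forall z, U z -> is_derive z.1 (1 : R) (fun s => f (s, z.2)) (dr f z).
  by move=> [df _ _] z Uz; rewrite /dr derive1E; apply/derivableP/df.
have mk f g : C0 U f -> C0 U g ->
    (forall z, U z -> is_derive z.1 (1 : R) (fun s => f (s, z.2)) (g z)) -> C1 f.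
  move=> Cf Cg fg; split=> // [z /fg[]//|].
  apply: (class_eq C0U _ Cg) => z /fg ?; rewrite /dr derive1E.
  by symmetry; apply: derive_val.
split.
- move=> f g fg Cf; apply: (mk _ (dr f)).
  + by case: Cf => _ ? _; exact: (class_eq C0U fg).
  + by case: Cf.
  + move=> z Uz; have := isd _ Cf z Uz; apply: near_eq_is_derive.
    by apply: filterS (near_slice Uz) => s /fg.
- by move=> c; apply: (mk _ (fun=> 0)); [exact: (class_cst C0U)..|move=> z Uz; exact: is_derive_cst].
- move=> f g Cf Cg; have [_ f0 f1] := Cf; have [_ g0 g1] := Cg.
  apply: (mk _ (fun z => dr f z + dr g z)); [exact: (class_add C0U)..|].
  by move=> z Uz; apply: is_deriveD; exact: isd.
- move=> f g Cf Cg; have [_ f0 f1] := Cf; have [_ g0 g1] := Cg.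
  apply: (mk _ (fun z => f z * dr g z + g z * dr f z)).
  + exact: (class_mul C0U).
  + by apply: (class_add C0U) => //; exact: (class_mul C0U).
  + by move=> [r p] Uz; apply: is_deriveM; exact: (isd _ _ (r, p)).
- move=> f fn0 Cf; have [_ f0 f1] := Cf.
  apply: (mk _ (fun z => (- ((f z) ^-1 * (f z)^-1)) * dr f z)).
  + exact: (class_inv C0U).
  + apply: (class_mul C0U) => //.
    apply: (class_eq C0U (f := fun z => -1 * ((f z)^-1 * (f z)^-1))).
      by move=> z _; rewrite mulN1r.
    by apply: (class_scale C0U) => //; apply: (class_mul C0U) => //; exact: (class_inv C0U).
  + move=> [r p] Uz; have := isd _ Cf _ Uz => /= ?.
    have fz0 : f (r, p) != 0 by exact: fn0.
    have dfr : derivable (fun s => f (s, p)) r 1 by case: Cf => /(_ _ Uz).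
    apply: DeriveDef; first exact: derivableV.
    by rewrite deriveV // derive_val -invfM -expr2.
Qed.

End RadialDerivative.

Section Pullback.
Variables (R : realType) (m : nat) (N : topologicalType) (U : set (R * N)).
Hypothesis oU : open U.
Variables (iota : R * N -> 'rV[R]_m) (i0 : 'I_m).
Hypothesis iota_cont : forall z, U z -> continuous_at z iota.
Hypothesis iota_line : forall r s p,
  iota (s + r, p) = s *: basis_vec R i0 + iota (r, p).

(** Functions on [R * N] which are locally smooth functions of the coordinates
    [iota z]. The line [s |-> (s, p)] is a coordinate line, so that [dr] is the
    partial derivative along it. *)
Definition pullback (f : R * N -> R) := forall z, U z -> exists V F,
  [/\ open V, V (iota z), Cinfty V F & \forall w \near z, f w = F (iota w)].

Lemma Cinfty_derive (V : set 'rV[R]_m) (F : 'rV[R]_m -> R) i : Cinfty V F ->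
  Cinfty V (fun x => 'D_(basis_vec R i) F x).
Proof.
move=> CF s x Vx; have := CF (rcons s i) x Vx.
by rewrite /iter_partial foldr_rcons.
Qed.

Lemma pullback_derive f z V F : V (iota z) -> Cinfty V F ->
  (\forall w \near z, f w = F (iota w)) ->
  is_derive z.1 (1 : R) (fun s => f (s, z.2)) ('D_(basis_vec R i0) F (iota z)).
Proof.
case: z => [r p] /= Vz CF fF.
have near_s : \forall s \near r, F (iota (s, p)) = f (s, p).
  have : continuous_at r (fun s : R => (s, p)).
    by apply: (@cvg_pair _ _ _ _ (nbhs r) (nbhs p)); [exact: cvg_id|exact: cvg_cst].
  by move=> /(_ [set w | F (iota w) = f w]); apply; apply: filterS fF => w /esym.
apply: near_eq_is_derive near_s _.
have E : (fun h => h^-1 *: (((fun s => F (iota (s, p))) \o shift r) (h *: (1 : R))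
     - F (iota (r, p)))) =
  (fun h => h^-1 *: ((F \o shift (iota (r, p))) (h *: basis_vec R i0) - F (iota (r, p)))).
  by apply/funext => h /=; rewrite iota_line -[h *: 1]/(h * 1) mulr1.
have [_ /(_ i0) dF] := CF [::] _ Vz.
by apply: DeriveDef; rewrite /derivable /derive E.
Qed.

(** The class of pullbacks is stable under [dr], hence this lemma can be
    iterated: it gives the entries of the metric as many derivatives in [r] as
    wanted. *)
Lemma pullback_C1 f : pullback f -> C1 U f /\ pullback (dr f).
Proof.
move=> pf.
have near_dr z V F : U z -> open V -> V (iota z) -> Cinfty V F ->
   (\forall w \near z, f w = F (iota w)) ->
   \forall w \near z, dr f w = 'D_(basis_vec R i0) F (iota w).
  move=> Uz oV Vz CF fF.
  have nV : \forall w \near z, V (iota w).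
    by apply: iota_cont => //; exact: open_nbhs_nbhs.
  near=> w.
  rewrite /dr derive1E.
  have Vw : V (iota w) by near: w.
  have fw : \forall y \near w, f y = F (iota y) by near: w; exact: nbhs_interior.
  by have ? := pullback_derive Vw CF fw; rewrite derive_val.
have C0p g : pullback g -> C0 U g.
  move=> pg z Uz; have [V [F [oV Vz CF gF]]] := pg z Uz.
  rewrite /continuous_at (nbhs_singleton gF).
  have [CF0 _] := CF [::] _ Vz.
  have := continuous_comp (iota_cont Uz) CF0.
  apply: cvg_trans; apply: near_eq_cvg.
  by apply: filterS gF => w ->.
have pdr : pullback (dr f).
  move=> z Uz; have [V [F [oV Vz CF fF]]] := pf z Uz.
  exists V, (fun x => 'D_(basis_vec R i0) F x); split=> //.
    exact: Cinfty_derive.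
  exact: (near_dr z V F).
split=> //; split; [|exact: C0p|exact: C0p].
move=> z Uz; have [V [F [oV Vz CF fF]]] := pf z Uz.
by have [] := pullback_derive Vz CF fF.
Unshelve. all: by end_near. Qed.

End Pullback.

Lemma mx_continuous (R : realType) (T : topologicalType) m n
  (f : T -> 'M[R]_(m, n)) z :
  (forall i j, continuous_at z (fun w => f w i j)) -> continuous_at z f.
Proof.
move=> fc A [P Pz PA].
have /= H : \forall w \near z, forall i j, P i j (f w i j).
  by apply: filter_forall => i; apply: filter_forall => j; exact: fc.
by apply: filterS H => w H; exact: PA.
Qed.

Lemma open_above (R : realType) (a : \bar R) : open [set r : R | (a < r%:E)%E].
Proof.
case: a => [x| |].
- by rewrite (_ : [set r | _] = [set r | x < r]) //; exact: open_gt.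
- by rewrite (_ : [set r | _] = set0); [exact: open0|apply/seteqP; split].
- rewrite (_ : [set r | _] = setT); first exact: openT.
  by apply/seteqP; split => // r _; exact: ltNyr.
Qed.

Lemma open_slab (R : realType) (N : topologicalType) (a : \bar R) :
  open [set z : R * N | (a < z.1%:E)%E].
Proof.
apply: (@open_comp _ _ fst [set r : R | (a < r%:E)%E]); last exact: open_above.
by move=> z _; exact: cvg_fst.
Qed.

(** * The metric in product charts *)

Section Cylinder.
Variables (R : realType) (d : nat) (N : ptopologicalType).
Variables (X : smooth_manifold R d N) (a : \bar R) (G : R -> tensor X).
Hypothesis hG : metric_family a G.

Definition cyl (i : atlas X) : set (R * N) :=
  [set z | (a < z.1%:E)%E /\ cdom (X i) z.2].

Lemma cyl_open i : open (cyl i).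
Proof.
rewrite openE => -[r p] [/= ar ip].
exists ([set r | (a < r%:E)%E], cdom (X i)); last by move=> [s q].
by split; [exact: (open_nbhs_nbhs (conj (@open_above R a) ar))
          |exact: (open_nbhs_nbhs (conj (@cdom_open _ _ _ (X i)) ip))].
Qed.

Lemma chart_continuous i p : cdom (X i) p -> continuous_at p (cmap (X i)).
Proof.
move=> ip; have := @cmap_continuous _ _ _ (X i).
rewrite continuous_open_subspace; last exact: cdom_open.
by move=> /(_ p (mem_set ip)).
Qed.

Definition iota_cyl (i : atlas X) (z : R * N) : 'rV[R]_(1 + d) :=
  row_mx (const_mx z.1 : 'rV[R]_1) (cmap (X i) z.2).

Lemma iota_cyl_continuous i z : cyl i z -> continuous_at z (iota_cyl i).
Proof.
move=> [_ iz]; apply: mx_continuous => k j; rewrite (ord1 k) /iota_cyl.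
case: (split_ordP j) => l ->.
  rewrite (_ : (fun w => _) = fst); first exact: cvg_fst.
  by apply/funext => w; rewrite row_mxEl mxE.
rewrite (_ : (fun w => _) = (fun x : 'rV[R]_d => x 0 l) \o (cmap (X i) \o snd)); last first.
  by apply/funext => w; rewrite row_mxEr.
apply: (@continuous_comp _ _ _ (cmap (X i) \o snd)); last exact: coord_continuous.
apply: (@continuous_comp _ _ _ snd); first exact: cvg_snd.
exact: chart_continuous.
Qed.

Lemma row_mx_radial_shift (t : R) (v : 'rV[R]_d) s : row_mx (const_mx (s + t) : 'rV[R]_1) v =
   s *: basis_vec R (0 : 'I_(1 + d)) + row_mx (const_mx t) v.
Proof.
apply/rowP => j; rewrite [RHS]mxE [X in _ = X + _]mxE [basis_vec _ _ _ _]mxE.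
case: (split_ordP j) => k ->.
  by rewrite !row_mxEl !mxE (ord1 k) eqxx mulr1.
by rewrite !row_mxEr [_ && _](_ : _ = false) ?mulr0 ?add0r.
Qed.

Definition radial_mx (i : atlas X) (z : R * N) : 'M[R]_d :=
  \matrix_(b, c) derive1 (fun s => G s i z.2 b c) z.1.

Lemma metric_pullback i b c :
  pullback (cyl i) (iota_cyl i) (fun z => G z.1 i z.2 b c).
Proof.
move=> [r p] [/= ar ip].
have [V [F [oV Vx CF VF]]] : exists V F, [/\ open V, V (iota_cyl i (r, p)), Cinfty V F &
    {in V `&` cyl_range a i, (fun z => cyl_metric G i z (rshift 1 b) (rshift 1 c)) =1 F}].
  apply: hG.2; split; first by rewrite row_mxKl mxE.
  by rewrite row_mxKr; exists p.
exists V, F; split=> //.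
have nV : \forall w \near (r, p), V (iota_cyl i w).
  by apply: iota_cyl_continuous => //; exact: open_nbhs_nbhs.
have nU : \forall w \near (r, p), cyl i w.
  by apply: open_nbhs_nbhs; split; [exact: cyl_open|].
near=> w.
have [aw iw] : cyl i w by near: w.
have Vw : V (iota_cyl i w) by near: w.
rewrite -VF; last first.
  by rewrite inE; split => //; split; rewrite ?row_mxKl ?row_mxKr ?mxE //; exists w.2.
by rewrite /cyl_metric block_mxEdr row_mxKl row_mxKr mxE (cmapK (mem_set iw)).
Unshelve. all: by end_near. Qed.

Lemma metric_C1 i b c : C1 (cyl i) (fun z => G z.1 i z.2 b c) /\
  C1 (cyl i) (fun z => radial_mx i z b c).
Proof.
have io : forall r s p, iota_cyl i (s + r, p) = s *: basis_vec R (0 : 'I_(1+d)) + iota_cyl i (r, p).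
  by move=> r s p; exact: row_mx_radial_shift.
have [C1G pG] := pullback_C1 (@iota_cyl_continuous i) io (@metric_pullback i b c).
have [C1dG _] := pullback_C1 (@iota_cyl_continuous i) io pG.
split=> //.
by apply: (class_eq (C1_class (@cyl_open i)) _ C1dG) => z _; rewrite /radial_mx mxE.
Qed.

End Cylinder.

(** * Ricci curvature in the radial direction *)

Section Metric.
Variables (R : realType) (d : nat) (N : ptopologicalType).
Variables (X : smooth_manifold R d N).

Lemma riemannian_posdef (g : tensor X) i p : riemannian_metric g ->
  cdom (X i) p -> posdef (g i p).
Proof.
by move=> hg ip; split; [exact: (Defs.metric_sym hg)|move=> v; exact: (metric_pos hg)].
Qed.

End Metric.

Section Ricci.
Variables (R : realType) (d : nat) (N : ptopologicalType).
Variables (X : smooth_manifold R d N) (a : \bar R) (G : R -> tensor X).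
Hypothesis hG : metric_family a G.
Variable i : atlas X.
Let S := cyl_range a i.
Let g := cyl_metric G i.

Definition mean_curv_in (z : R * N) : R :=
  2^-1 * \tr (invmx (G z.1 i z.2) *m radial_mx G i z).

Definition shape_sq_in (z : R * N) : R :=
  4^-1 * \tr (invmx (G z.1 i z.2) *m radial_mx G i z
              *m (invmx (G z.1 i z.2) *m radial_mx G i z)).

Lemma iota_cyl_range z : cyl a i z -> S (iota_cyl i z).
Proof.
by move=> [az iz]; split; rewrite ?row_mxKl ?row_mxKr ?mxE //; exists z.2.
Qed.

Lemma cyl_rangeP x : S x -> exists2 z, cyl a i z & x = iota_cyl i z.
Proof.
move=> [ax [p ip pE]]; exists (lsubmx x 0 0, p) => //.
rewrite /iota_cyl /= pE -[LHS]hsubmxK; congr row_mx.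
by apply/matrixP => k l; rewrite (ord1 k) (ord1 l) [RHS]mxE.
Qed.

(** Derivatives along the range of a boundary chart are limits of one-sided
    increments. They are limits along a proper filter because a half-space is
    stable under the addition of nonnegative multiples of the basis vectors. *)
Lemma range_proper x j : S x ->
  ProperFilter (within [set t : R | S (x + t *: basis_vec R j)] 0^').
Proof.
move=> Sx; apply: Build_ProperFilter_ex => //.
move=> A wA.
have wA' : \forall t \near (0 : R), t != 0 -> S (x + t *: basis_vec R j) -> A t by [].
have pos : \forall t \near (0 : R)^'+, S (x + t *: basis_vec R j).
  have [[ax xi] [V oV VE]] := (Sx, @cmap_image _ _ _ (X i)).
  have lineC : continuous_at (0 : R) (fun t : R => x + t *: basis_vec R j).
    apply: cvgD; first exact: cvg_cst.
    by apply: cvgZl; exact: cvg_id.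
  have line0 : x + 0 *: basis_vec R j = x by rewrite scale0r addr0.
  have coordC l : continuous_at (0 : R) (fun t : R => (x + t *: basis_vec R j) 0 l).
    by apply: (@continuous_comp _ _ _ _ (fun y : 'rV[R]_(1 + d) => y 0 l) _ lineC); exact: coord_continuous.
  have lC k : continuous_at (0 : R) (fun t : R => lsubmx (x + t *: basis_vec R j) 0 k).
    by under eq_fun do rewrite mxE; exact: coordC.
  have near_a : \forall t \near (0 : R), (a < (lsubmx (x + t *: basis_vec R j) 0 0)%:E)%E.
    apply: (lC 0 [set r | (a < r%:E)%E]); rewrite line0.
    by apply: open_nbhs_nbhs; split=> //; exact: open_above.
  have rC : continuous_at (0 : R) (fun t : R => rsubmx (x + t *: basis_vec R j)).
    apply: mx_continuous => k l; under eq_fun do rewrite mxE.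
    by rewrite (ord1 k); exact: coordC.
  have xVH : (V `&` @half_space R d) (rsubmx x) by rewrite -VE.
  have near_V : \forall t \near (0 : R), V (rsubmx (x + t *: basis_vec R j)).
    apply: (rC V); rewrite line0.
    by apply: open_nbhs_nbhs; split=> //; case: xVH.
  near=> t; split; first by near: t; exact: cvg_within near_a.
  rewrite /chart_range VE; split; first by near: t; exact: cvg_within near_V.
  move=> k k0; rewrite !mxE; apply: addr_ge0.
    by have := xVH.2 k k0; rewrite mxE.
  by apply: mulr_ge0.
near (0:R)^'+ => t.
exists t; have t0 : t != 0 by [].
have St : S (x + t *: basis_vec R j) by near: t.
move: t0 St; near: t.
exact: cvg_within wA'.
Unshelve. all: by end_near. Qed.

Lemma partial_cst j f c x : S x -> (forall y, S y -> f y = c) -> partial S j f x = 0.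
Proof.
move=> Sx fc; have FP := range_proper j Sx.
apply: cvg_lim => //; apply: cvg_trans (cvg_cst (0 : R)).
apply: near_eq_cvg.
apply: filterS (withinT _ _) => t St.
  by rewrite !fc // subrr mulr0.
exact: within_filter.
Qed.

(** The radial coordinate ranges over an open interval, so the radial derivative
    is two-sided, also at the boundary points of [N]. *)
Lemma partial0 f z : cyl a i z ->
  partial S 0 f (iota_cyl i z) = dr (f \o iota_cyl i) z.
Proof.
case: z => r p [/= ar ip]; rewrite /partial /dr /derive1 /=.
have -> : within [set t : R | S (iota_cyl i (r, p) + t *: basis_vec R 0)] 0^' = 0^'.
  apply/seteqP; split=> A wA; last by apply: filterS wA.
  have near_a : \forall t \near (0 : R), (a < (t + r)%:E)%E.
    have tr : continuous_at (0 : R) (fun t => t + r) by apply: cvgD; [exact: cvg_id|exact: cvg_cst].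
    have /tr : nbhs (0 + r) [set s : R | (a < s%:E)%E].
      by rewrite add0r; apply: open_nbhs_nbhs; split=> //; exact: open_above.
    by [].
  have wA' : \forall t \near (0 : R), t != 0 -> S (iota_cyl i (r, p) + t *: basis_vec R 0) -> A t by [].
  rewrite /dnbhs /within /=; near=> t => t0.
  have St : S (iota_cyl i (r, p) + t *: basis_vec R 0).
    rewrite addrC -[X in S X](@row_mx_radial_shift R d r (cmap (X i) p) t).
    apply: (@iota_cyl_range (t + r, p)); split=> //=.
    by near: t.
  by move: t0 St; near: t.
have -> // : (fun t : R => t^-1 * (f (iota_cyl i (r, p) + t *: basis_vec R 0)
      - f (iota_cyl i (r, p)))) =
   (fun h => h^-1 *: (f (iota_cyl i (h + r, p)) - f (iota_cyl i (r, p)))).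
apply/funext => t; congr (_ * (f _ - _)); rewrite addrC; symmetry.
exact: row_mx_radial_shift.
Unshelve. all: by end_near. Qed.

Lemma dr_congr (f f' : R * N -> R) z : cyl a i z ->
  (forall w, cyl a i w -> f w = f' w) -> dr f z = dr f' z.
Proof.
move=> Uz ff'; rewrite /dr !derive1E; apply: near_eq_derive.
by apply: filterS (near_slice (@cyl_open _ _ _ X a i) Uz) => s /ff'.
Qed.

Lemma cyl_metric_unit z : cyl a i z -> G z.1 i z.2 \in unitmx.
Proof.
by move=> [az iz]; apply: posdef_unit; apply: riemannian_posdef iz; apply: hG.1.
Qed.

Lemma radial_sym z : cyl a i z -> (radial_mx G i z)^T = radial_mx G i z.
Proof.
move=> Uz; apply/matrixP => b c; rewrite !mxE.
apply: (@dr_congr (fun z => G z.1 i z.2 c b) (fun z => G z.1 i z.2 b c) z Uz).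
move=> w [aw iw]; have /matrixP/(_ b c) := Defs.metric_sym (hG.1 _ aw) iw.
by rewrite mxE.
Qed.

Lemma cyl_metricE z : cyl a i z -> g (iota_cyl i z) = block_mx 1%:M 0 0 (G z.1 i z.2).
Proof.
move=> [_ iz]; rewrite /g /cyl_metric row_mxKl row_mxKr mxE.
by rewrite (cmapK (mem_set iz)).
Qed.

Lemma invmx_cyl_metric z : cyl a i z ->
  invmx (g (iota_cyl i z)) = block_mx 1%:M 0 0 (invmx (G z.1 i z.2)).
Proof.
move=> Uz; rewrite cyl_metricE //.
have Gu := cyl_metric_unit Uz.
apply: invmx_unique.
  by rewrite unitmxE det_ublock det1 mul1r -unitmxE.
by rewrite mulmx_block !mulmx0 !mul0mx !addr0 mul1mx add0r mulmxV // -scalar_mx_block.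
Qed.

Lemma metric_row0 l y : g y 0 l = (l == 0)%:R.
Proof.
rewrite /g /cyl_metric.
have -> : (0 : 'I_(1 + d)) = lshift d (0 : 'I_1) by exact/val_inj.
case: (split_ordP l) => k ->.
  by rewrite block_mxEul mxE (ord1 k) eqxx.
by rewrite block_mxEur mxE.
Qed.

Lemma partial_metric_row0 j l x : S x -> partial S j (fun y => g y 0 l) x = 0.
Proof. by move=> Sx; apply: (@partial_cst _ _ (l == 0)%:R) => // y _; exact: metric_row0. Qed.

Lemma partial0_metric m l z : cyl a i z ->
  partial S 0 (fun y => g y m l) (iota_cyl i z) =
  block_mx (0 : 'M[R]_1) 0 0 (radial_mx G i z) m l.
Proof.
move=> Uz; rewrite partial0 //; move: m l.
have E m l (f : R * N -> R) : (forall w, cyl a i w -> block_mx (1%:M : 'M[R]_1) 0 0 (G w.1 i w.2) m l = f w) ->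
    dr ((fun y => g y m l) \o iota_cyl i) z = dr f z.
  by move=> Ef; apply: dr_congr => // w Uw /=; rewrite cyl_metricE // Ef.
have dr_cst (c : R) : dr (fun=> c) z = 0 by rewrite /dr derive1_cst.
move=> m l; case: (split_ordP m) => b ->; case: (split_ordP l) => c ->.
- rewrite (E _ _ (fun=> (b == c)%:R)) ?dr_cst ?block_mxEul ?mxE //.
  by move=> w _; rewrite block_mxEul mxE.
- by rewrite (E _ _ (fun=> 0)) ?dr_cst ?block_mxEur ?mxE // => w _; rewrite block_mxEur mxE.
- by rewrite (E _ _ (fun=> 0)) ?dr_cst ?block_mxEdl ?mxE // => w _; rewrite block_mxEdl mxE.
- rewrite (E _ _ (fun w => G w.1 i w.2 b c)) ?block_mxEdr ?mxE //.
  by move=> w _; rewrite block_mxEdr.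
Qed.

(** The Weingarten map of the slices [{r} * N], extended by zero on d/dr. *)
Definition shape_mx z : 'M[R]_(1 + d) :=
  block_mx 0 0 0 (2^-1 *: (invmx (G z.1 i z.2) *m radial_mx G i z)).

(** The radial lines are geodesics. *)
Lemma christoffel00 k x : S x -> christoffel S g k 0 0 x = 0.
Proof.
move=> Sx; rewrite /christoffel big1 ?mulr0 // => l _.
by rewrite !partial_metric_row0 // addr0 subr0 mulr0.
Qed.

(** The coefficients of the metric with an index 0 are constant, so of the three
    derivatives in the symbol only the radial one remains. *)
Lemma christoffel0 k m z : cyl a i z ->
  christoffel S g k 0 m (iota_cyl i z) = shape_mx z k m.
Proof.
move=> Uz; have Sx := iota_cyl_range Uz.
rewrite /christoffel.
under eq_bigr => l _ do
  rewrite !(partial_metric_row0 _ _ Sx) addr0 subr0 partial0_metric // invmx_cyl_metric //.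
have -> : shape_mx z = 2^-1 *: (block_mx 1%:M 0 0 (invmx (G z.1 i z.2))
    *m (block_mx (0 : 'M[R]_1) 0 0 (radial_mx G i z))^T).
  rewrite tr_block_mx !trmx0 radial_sym // mulmx_block !mulmx0 !mul0mx !addr0 add0r.
  by rewrite /shape_mx scale_block_mx !scaler0.
rewrite mxE [in RHS]mxE; congr (_ * _).
by apply: eq_bigr => l _; rewrite [X in _ = _ * X]mxE.
Qed.

Lemma shape_class :
  class_mx (C1 (cyl a i)) (fun z => invmx (G z.1 i z.2) *m radial_mx G i z).
Proof.
have CC := C1_class (@cyl_open _ _ _ X a i).
apply: (class_mulmx CC).
  apply: (class_invmx CC); first exact: cyl_metric_unit.
  by move=> b c; exact: (metric_C1 hG i b c).1.
by move=> b c; exact: (metric_C1 hG i b c).2.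
Qed.

Lemma mean_curv_in_C1 : C1 (cyl a i) mean_curv_in.
Proof.
have CC := C1_class (@cyl_open _ _ _ X a i).
by apply: (class_scale CC); apply: (class_trace CC); exact: shape_class.
Qed.

Lemma shape_sq_in_C0 : C0 (cyl a i) shape_sq_in.
Proof.
have CC := @C0_class R _ _ (@cyl_open _ _ _ X a i).
have S0 : class_mx (C0 (cyl a i)) (fun z => invmx (G z.1 i z.2) *m radial_mx G i z).
  by move=> b c; have [] := shape_class b c.
by apply: (class_scale CC); apply: (class_trace CC); exact: (class_mulmx CC).
Qed.

(** The trace of the Riccati equation [W' + W^2 + R(., d/dr) d/dr = 0] of the
    Weingarten map [W]. Since d/dr is geodesic, only the symbols with one lower
    index equal to 0 survive in the Ricci tensor, and these are the entries of
    [W]. *)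
Lemma ricci_cyl z : cyl a i z ->
  ricci S g 0 0 (iota_cyl i z) = - dr mean_curv_in z - shape_sq_in z.
Proof.
move=> Uz; have Sx := iota_cyl_range Uz; rewrite /ricci.
have -> : \sum_j (partial S j (christoffel S g j 0 0) (iota_cyl i z) -
      partial S 0 (christoffel S g j 0 j) (iota_cyl i z)) =
    - \sum_j dr (fun w => shape_mx w j j) z.
  rewrite -sumrN; apply: eq_bigr => j _.
  rewrite (@partial_cst _ _ 0) ?sub0r //; last by move=> y; exact: christoffel00.
  congr (- _); rewrite partial0 //.
  by apply: dr_congr => // w Uw; exact: christoffel0.
have -> : \sum_j \sum_l (christoffel S g j j l (iota_cyl i z) *
    christoffel S g l 0 0 (iota_cyl i z) - christoffel S g j 0 l (iota_cyl i z) *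
    christoffel S g l 0 j (iota_cyl i z)) = - \tr (shape_mx z *m shape_mx z).
  rewrite /mxtrace -sumrN; apply: eq_bigr => j _; rewrite [in RHS]mxE -sumrN.
  apply: eq_bigr => l _.
  by rewrite christoffel00 // mulr0 sub0r !christoffel0.
congr (- _ - _); last first.
  rewrite /shape_mx mulmx_block !mulmx0 !mul0mx !addr0 add0r mxtrace_block.
  rewrite mxtrace0 add0r -scalemxAl -scalemxAr scalerA mxtraceZ /shape_sq_in.
  by congr (_ * _); rewrite -invfM -natrM.
have CC := C1_class (@cyl_open _ _ _ X a i).
have Cs j : C1 (cyl a i) (fun w => shape_mx w j j).
  case: (split_ordP j) => b ->.
    by apply: (class_eq CC _ (class_cst CC 0)) => w _; rewrite /shape_mx block_mxEul mxE.
  apply: (class_eq CC (f := fun w => 2^-1 * (invmx (G w.1 i w.2) *m radial_mx G i w) b b)).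
    by move=> w _; rewrite /shape_mx block_mxEdr [RHS]mxE.
  by apply: (class_scale CC); exact: shape_class.
rewrite (@dr_congr mean_curv_in (fun w => \sum_j shape_mx w j j)) //; last first.
  move=> w Uw; rewrite -/(mxtrace (shape_mx w)) /shape_mx mxtrace_block mxtrace0 add0r.
  by rewrite mxtraceZ.
rewrite /dr derive1E (eq_bigr (fun j => 'D_1 (fun s => shape_mx (s, z.2) j j) z.1)).
  rewrite -derive_sum; last by move=> j; case: (Cs j) => /(_ _ Uz).
  by have -> : (fun s => \sum_j shape_mx (s, z.2) j j) =
      \sum_j (fun s => shape_mx (s, z.2) j j) by apply/funext => s; rewrite fct_sumE.
by move=> j _; rewrite derive1E.
Qed.

End Ricci.

(** * Curvature functions on the whole manifold *)

Section Calculus.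
Variable R : realType.

Lemma is_derive_sumf (I : Type) (s : seq I) (f : I -> R -> R) (df : I -> R) x :
  (forall i, is_derive x (1 : R) (f i) (df i)) ->
  is_derive x (1 : R) (fun t => \sum_(i <- s) f i t) (\sum_(i <- s) df i).
Proof.
move=> fdf; elim: s => [|i s IH].
  rewrite big_nil (_ : (fun t => _) = cst 0); first exact: is_derive_cst.
  by apply/funext => t; rewrite big_nil.
rewrite big_cons (_ : (fun t => _) = f i + (fun t => \sum_(j <- s) f j t)).
  exact: is_deriveD.
by apply/funext => t; rewrite big_cons.
Qed.

Lemma derive1_congruence m n p q (A : 'M[R]_(m, n)) (B : R -> 'M[R]_(n, p))
  (C : 'M[R]_(p, q)) x :
  (forall i j, derivable (fun t => B t i j) x 1) ->
  \matrix_(i, j) derive1 (fun t => (A *m B t *m C) i j) x =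
  A *m (\matrix_(i, j) derive1 (fun t => B t i j) x) *m C.
Proof.
move=> dB; apply/matrixP => i j; rewrite mxE derive1E.
have -> : (fun t => (A *m B t *m C) i j) =
    (fun t => \sum_k \sum_l (A i l * C k j) * B t l k).
  apply/funext => t; rewrite mxE; apply: eq_bigr => k _.
  by rewrite mxE mulr_suml; apply: eq_bigr => l _; rewrite mulrAC.
have -> : (A *m (\matrix_(k, l) derive1 (fun t => B t k l) x) *m C) i j =
    \sum_k \sum_l (A i l * C k j) * 'D_1 (fun t => B t l k) x.
  rewrite mxE; apply: eq_bigr => k _.
  rewrite mxE mulr_suml; apply: eq_bigr => l _; rewrite mulrAC.
  by rewrite [X in _ * X = _]mxE derive1E.
apply: derive_val.
apply: is_derive_sumf => k; apply: is_derive_sumf => l.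
by apply: is_deriveZ; exact/derivableP.
Qed.

End Calculus.

Lemma is_derive_hring (R : realType) (k r : R) :
  is_derive r (1 : R) (hring k) (hring (- k) r).
Proof.
rewrite /hring.
have -> : expR r + - k * expR (-r) = expR r + k * (expR (- r) * -1) by ring.
have -> : (fun r => expR r + k * expR (- r)) = expR + k \*: (expR \o -%R) by [].
apply: is_deriveD; apply: is_deriveZ.
Qed.

Section Density.
Variables (R : realType) (d : nat) (N : ptopologicalType).
Variables (X : smooth_manifold R d N) (a : \bar R) (G : R -> tensor X).
Hypothesis hG : metric_family a G.
Let U : set (R * N) := [set z | (a < z.1%:E)%E].
Let oU : open U := @open_slab R N a.

Lemma cyl_chart_at z : U z -> cyl a (chart_at X z.2) z.
Proof. by move=> az; split=> //; exact: chart_atP. Qed.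

(** The changes of charts of [N] do not depend on [r], therefore [dG/dr] obeys
    the transformation law of [G]. *)
Lemma radial_compat i j z : cyl a i z -> cyl a j z ->
  radial_mx G i z = (transition_jacobian i j z.2)^T *m radial_mx G j z
     *m transition_jacobian i j z.2.
Proof.
case: z => r p Ui Uj; rewrite -derive1_congruence; last first.
  move=> b c; have [[dG _ _] _] := metric_C1 hG j b c.
  exact: (dG _ Uj).
apply/matrixP => b c; rewrite !mxE !derive1E; apply: near_eq_derive.
apply: filterS (near_slice (@cyl_open _ _ _ X a i) Ui) => s [/= as_ ip].
by have /= -> := metric_compat (hG.1 _ as_) ip Uj.2.
Qed.

Lemma mean_curv_in_indep i j z : cyl a i z -> cyl a j z ->
  mean_curv_in G i z = mean_curv_in G j z.
Proof.
move=> Ui Uj; rewrite /mean_curv_in (radial_compat Ui Uj); congr (_ * _).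
apply: congruence_trace; first exact: (cyl_metric_unit hG Ui).
exact: (metric_compat (hG.1 _ Ui.1) Ui.2 Uj.2).
Qed.

Lemma shape_sq_in_indep i j z : cyl a i z -> cyl a j z ->
  shape_sq_in G i z = shape_sq_in G j z.
Proof.
move=> Ui Uj; rewrite /shape_sq_in (radial_compat Ui Uj); congr (_ * _).
apply: congruence_trace2; first exact: (cyl_metric_unit hG Ui).
exact: (metric_compat (hG.1 _ Ui.1) Ui.2 Uj.2).
Qed.

(** At [(r, p)] the curvatures are read in the chart chosen at [p]. This choice
    need not depend continuously on [p]; the functions are regular nevertheless,
    because the values do not depend on the chart. *)
Definition mean_curv z := mean_curv_in G (chart_at X z.2) z.
Definition shape_sq z := shape_sq_in G (chart_at X z.2) z.

Lemma mean_curv_C1 : C1 U mean_curv.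
Proof.
have C (i : atlas X) : C1 (cyl a i) mean_curv.
  apply: (class_eq (C1_class (@cyl_open _ _ _ X a i)) _ (mean_curv_in_C1 hG i)) => w Uw.
  by apply: mean_curv_in_indep => //; apply: cyl_chart_at; case: Uw.
by split=> z Uz; have [] := C (chart_at X z.2) => H1 H2 H3;
  [apply: H1|apply: H2|apply: H3]; exact: cyl_chart_at.
Qed.

Lemma shape_sq_C0 : C0 U shape_sq.
Proof.
move=> z Uz; have Cz := cyl_chart_at Uz; move: z Uz Cz.
suff C (i : atlas X) : C0 (cyl a i) shape_sq by move=> z Uz; exact: C.
have CC := @C0_class R _ _ (@cyl_open _ _ _ X a i).
apply: (class_eq CC _ (@shape_sq_in_C0 _ _ _ _ _ _ hG i)) => w Uw.
by apply: shape_sq_in_indep => //; apply: cyl_chart_at; case: Uw.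
Qed.

Lemma ricci_rrE z : U z -> ricci_rr a G z.1 z.2 = - dr mean_curv z - shape_sq z.
Proof.
move=> Uz; have Cz := cyl_chart_at Uz.
rewrite /ricci_rr -[row_mx _ _]/(iota_cyl (chart_at X z.2) z) ricci_cyl //.
Qed.

Section Profile.
Variable k : R.
Let h := hring k.
Let h' := hring (- k).

(** The integrand [h^2 (d h'/h - H)] of the relative radial mass, where
    [h' = hring (- k)] is the derivative of [h = hring k] and conversely. *)
Definition mass_density z := d%:R * (h z.1 * h' z.1) - h z.1 ^+ 2 * mean_curv z.
Definition ricci_density z := h z.1 ^+ 2 * (ricci_rr a G z.1 z.2 + d%:R).

(** The squared norm of [h' - h W], with [W] the Weingarten map: it measures the
    failure of the slices to be umbilical with the principal curvature [h'/h] of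
    the model. *)
Definition defect z := let i := chart_at X z.2 in
  sqnorm (G z.1 i z.2) (h' z.1 *: G z.1 i z.2 - (h z.1 / 2) *: radial_mx G i z).

Lemma defect_ge0 z : U z -> 0 <= defect z.
Proof.
move=> /cyl_chart_at[az iz]; apply: sqnorm_ge0.
by apply: riemannian_posdef iz; exact: hG.1.
Qed.

Lemma hring_C1 j : C1 U (fun z : R * N => hring j z.1).
Proof.
have hc l r : continuous_at r (hring l).
  by apply: differentiable_continuous; apply/derivable1_diffP; have [] := is_derive_hring l r.
split.
- by move=> z _; have [] := is_derive_hring j z.1.
- by move=> z _; apply: (@continuous_comp _ _ _ fst (hring j)); [exact: cvg_fst|exact: hc].
- move=> z _; have -> : dr (fun z : R * N => hring j z.1) = hring (- j) \o fst.
    by apply/funext => w; rewrite /dr derive1E; have ? := is_derive_hring j w.1; rewrite derive_val.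
  by apply: (@continuous_comp _ _ _ fst); [exact: cvg_fst|exact: hc].
Qed.

Lemma mass_density_C1 : C1 U mass_density.
Proof.
have CC := C1_class oU.
apply: (class_sub CC).
  by apply: (class_scale CC); apply: (class_mul CC); exact: hring_C1.
apply: (class_mul CC); last exact: mean_curv_C1.
by apply: (class_mul CC); exact: hring_C1.
Qed.

Lemma defectE z : U z -> defect z =
  d%:R * h' z.1 ^+ 2 - 2 * h' z.1 * h z.1 * mean_curv z + h z.1 ^+ 2 * shape_sq z.
Proof.
move=> /cyl_chart_at Cz; rewrite /defect sqnorm_conformal //.
  by case: Cz => az; apply: riemannian_posdef; exact: hG.1.
exact: radial_sym Cz.
Qed.

Lemma ricci_densityE z : U z -> ricci_density z =
  h z.1 ^+ 2 * (- dr mean_curv z - shape_sq z + d%:R).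
Proof. by move=> Uz; rewrite /ricci_density ricci_rrE. Qed.

(** The key identity. Substitute the Riccati equation in the derivative of
    [d h h' - h^2 H]; as [h'' = h], what remains besides the Ricci term is
    [d h'^2 - 2 h h' H + h^2 tr (W^2)], a perfect square. *)
Lemma dr_mass_density z : U z -> dr mass_density z = ricci_density z + defect z.
Proof.
move=> Uz; rewrite defectE // ricci_densityE //.
have [/(_ z Uz)/derivableP dm _ _] := mean_curv_C1.
rewrite -derive1E in dm.
case: z Uz dm => r p Uz /= dm.
have dh := is_derive_hring k r; have := is_derive_hring (- k) r.
rewrite opprK => dh'; rewrite [LHS]/dr [LHS]derive1E /=.
have D : is_derive r (1 : R)
   (d%:R \*: (h * h') - (h * h) * (fun s => mean_curv (s, p)))
   (d%:R *: (h r *: h r + h' r *: h' r) -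
     ((h * h) r *: dr mean_curv (r, p) + mean_curv (r, p) *: (h r *: h' r + h r *: h' r))).
  by apply: is_deriveB; apply: is_deriveM; exact: is_deriveM.
have -> : (fun s => mass_density (s, p)) =
   (d%:R \*: (h * h') - (h * h) * (fun s => mean_curv (s, p))).
  by apply/funext => s; rewrite /mass_density /= expr2.
rewrite derive_val.
have -> : (h * h) r = h r * h r by [].
rewrite /GRing.scale /=.
move: (dr mean_curv _) (mean_curv _) (shape_sq _) (h r) (h' r) => x y w u v.
ring.
Qed.

Lemma ricci_density_C0 : C0 U ricci_density.
Proof.
have CC := @C0_class R _ _ oU.
have [_ _ dmean] := mean_curv_C1.
have [_ h0 _] := hring_C1 k.
apply: (class_eq CC (f := fun z =>
   h z.1 * h z.1 * (d%:R - (dr mean_curv z + shape_sq z)))).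
  by move=> z Uz; rewrite ricci_densityE // -expr2; congr (_ * _); ring.
apply: (class_mul CC); first exact: (class_mul CC).
apply: (class_sub CC); first exact: (class_cst CC).
by apply: (class_add CC) => //; exact: shape_sq_C0.
Qed.

Lemma defect_eq0 z i : U z -> cdom (X i) z.2 -> defect z = 0 ->
  h z.1 *: radial_mx G i z = (2 * h' z.1) *: G z.1 i z.2.
Proof.
move=> Uz iz q0; have Cz := cyl_chart_at Uz.
have Ciz : cyl a i z by [].
have pd : posdef (G z.1 (chart_at X z.2) z.2).
  by case: Cz => az; apply: riemannian_posdef; exact: hG.1.
have /eqP := sqnorm_eq0 pd q0.
rewrite subr_eq0 => /eqP E.
have {}E : h z.1 *: radial_mx G (chart_at X z.2) z =
    (2 * h' z.1) *: G z.1 (chart_at X z.2) z.2.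
  by rewrite -scalerA E scalerA mulrCA mulfV ?mulr1 // pnatr_eq0.
rewrite (radial_compat Ciz Cz) (metric_compat (hG.1 _ Uz) iz Cz.2).
by rewrite scalemxAl scalemxAr E -scalemxAr -scalemxAl.
Qed.

Lemma defect_conformal0 z : U z ->
  h z.1 *: radial_mx G (chart_at X z.2) z =
    (2 * h' z.1) *: G z.1 (chart_at X z.2) z.2 -> defect z = 0.
Proof.
move=> Uz E; rewrite /defect /=.
have -> : h' z.1 *: G z.1 (chart_at X z.2) z.2 -
    (h z.1 / 2) *: radial_mx G (chart_at X z.2) z = 0.
  rewrite mulrC -scalerA E scalerA mulrA mulVf ?mul1r ?subrr // pnatr_eq0 //.
by rewrite /sqnorm mulmx0 !mul0mx mxtrace0.
Qed.

End Profile.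
End Density.

(** * The Riemannian measure *)

Section IteratedIntegral.
Variable R : realType.

(** The integral of a nonnegative function is the supremum of the integrals of
    the simple functions below it. In this form the comparison applies to
    iterated integrals, whose inner integrals may fail to be measurable. *)
Lemma le_integral_nonneg (f g : R -> \bar R) : (forall x, 0 <= f x)%E ->
  (forall x, f x <= g x)%E ->
  (\int[@lebesgue_measure R]_(x in setT) f x <=
   \int[@lebesgue_measure R]_(x in setT) g x)%E.
Proof.
move=> f0 fg; have g0 x : (0 <= g x)%E by exact: le_trans (fg x).
rewrite !ge0_integralTE //; apply: ereal_sup_le => _ [u uf <-].
by exists u => // x; exact: le_trans (fg x).
Qed.

Lemma iter_integral_ge0 d (f : 'rV[R]_d -> \bar R) :
  (forall x, 0 <= f x)%E -> (0 <= iter_integral f)%E.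
Proof.
elim: d f => [|d IH] f f0 //=.
by apply: integral_ge0 => t _; apply: IH => y; exact: f0.
Qed.

Lemma le_iter_integral d (f g : 'rV[R]_d -> \bar R) : (forall x, 0 <= f x)%E ->
  (forall x, f x <= g x)%E -> (iter_integral f <= iter_integral g)%E.
Proof.
elim: d f g => [|d IH] f g f0 fg //=.
apply: le_integral_nonneg => t; first by apply: iter_integral_ge0 => y; exact: f0.
by apply: IH => y; [exact: f0|exact: fg].
Qed.

Definition cube d (l : 'rV[R]_d) (w : R) : set 'rV[R]_d :=
  [set x | forall i, l 0 i <= x 0 i <= l 0 i + w].

Lemma iter_integral_cube d (l : 'rV[R]_d) (w c : R) : 0 <= w -> 0 <= c ->
  iter_integral (fun x => (c * \1_(cube l w) x)%:E) = (c * w ^+ d)%:E.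
Proof.
move=> w0; elim: d l c => [|d IH] l c c0.
  by rewrite /= indicE mem_set ?mulr1 ?expr0 ?mulr1 // => -[].
rewrite [LHS]/=.
pose I := `[l 0 0, l 0 0 + w]%classic.
rewrite -[d.+1]/(1 + d)%N in l I *.
have cubeE (t : R) (y : 'rV[R]_d) : \1_(cube l w) (row_mx (const_mx t : 'rV[R]_1) y) =
    \1_I t * \1_(cube (rsubmx l) w) y :> R.
  rewrite !indicE -natrM mulnb; congr (nat_of_bool _)%:R.
  apply/idP/andP => [/set_mem H|[/set_mem It /set_mem yl]]; rewrite ?inE.
    split=> [|i].
      have := H (lshift d 0); rewrite row_mxEl mxE /I /= in_itv /=.
      by rewrite (_ : lshift d 0 = 0) //; exact/val_inj.
    by have := H (rshift 1 i); rewrite row_mxEr !mxE.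
  move=> j; case: (split_ordP j) => i ->.
    rewrite row_mxEl mxE (ord1 i); move: It; rewrite /I /= in_itv /=.
    by rewrite (_ : lshift d 0 = 0) //; exact/val_inj.
  by have := yl i; rewrite row_mxEr !mxE.
under eq_integral => t _.
  under eq_fun => y do rewrite cubeE mulrA.
  rewrite IH; last by apply: mulr_ge0.
  rewrite mulrAC EFinM.
  over.
rewrite ge0_integralZl_EFin //=; last 2 first.
- by apply/measurable_EFinP; apply: measurable_indic; exact: measurable_itv.
- by apply: mulr_ge0 => //; exact: exprn_ge0.
rewrite integral_indic //; last exact: measurable_itv.
rewrite setIT exprSr mulrA [RHS]EFinM; congr (_ * _)%E.
transitivity (lebesgue_measure I); first by [].
rewrite lebesgue_measure_itv /= lte_fin.
case: ltP => [_|]; first by rewrite -EFinB addrAC subrr add0r.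
by rewrite gerDl => w_le0; congr (_%:E); apply/eqP; rewrite eq_le w0 w_le0.
Qed.

End IteratedIntegral.

Section Measure.
Variables (R : realType) (d : nat) (N : ptopologicalType).
Variables (X : smooth_manifold R d N) (g : tensor X).
Hypothesis hg : riemannian_metric g.
Variable mu : {measure set (borel N) -> \bar R}.
Hypothesis hmu : riemannian_measure g mu.

Lemma open_measurable_borel (A : set (borel N)) : @open N A -> measurable A.
Proof. by move=> oA; apply: sub_sigma_algebra. Qed.

Lemma metric_C0 (i : atlas X) b c : C0 (cdom (X i)) (fun p => g i p b c).
Proof.
move=> p ip.
have [|V [F [oV Vx CF VF]]] := Defs.metric_smooth hg (i := i) b c (x := cmap (X i) p).
  by exists p.
have [CF0 _] := CF [::] _ Vx.
have cm := chart_continuous ip.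
have nE : \forall q \near p, F (cmap (X i) q) = g i q b c.
  have nV : \forall q \near p, V (cmap (X i) q).
    by apply: cm; exact: open_nbhs_nbhs.
  have ni : \forall q \near p, cdom (X i) q.
    by apply: open_nbhs_nbhs; split=> //; exact: cdom_open.
  near=> q.
  have iq : cdom (X i) q by near: q.
  rewrite -VF; first by rewrite (cmapK (mem_set iq)).
  by rewrite inE; split; [near: q|exists q].
rewrite /continuous_at -(nbhs_singleton nE).
by apply: cvg_trans (continuous_comp cm CF0); exact: near_eq_cvg.
Unshelve. all: by end_near. Qed.

Lemma det_C0 (i : atlas X) : C0 (cdom (X i)) (fun p => \det (g i p)).
Proof.
apply: (class_det (@C0_class R _ _ (@cdom_open _ _ _ (X i)))) => b c.
exact: metric_C0.
Qed.

(** Near [p] the density is bounded and the chart takes its values in a cube. *)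
Lemma measure_locally_finite p : exists A : set N,
  [/\ open A, A p & (mu A < +oo)%E].
Proof.
pose i := chart_at X p; have ip : cdom (X i) p by exact: chart_atP.
pose M := \det (g i p) + 1.
have nM : \forall q \near p, \det (g i q) < M.
  by apply: (cvgr_lt _ (det_C0 ip)); rewrite ltrDl.
have ni : \forall q \near p, cdom (X i) q.
  by apply: open_nbhs_nbhs; split=> //; exact: cdom_open.
have nb : \forall q \near p, ball (cmap (X i) p) 1 (cmap (X i) q).
  by apply: (chart_continuous ip); exact: nbhsx_ballx.
pose l := \row_j (cmap (X i) p 0 j - 1).
pose W := [set q | [/\ \det (g i q) < M, cdom (X i) q & ball (cmap (X i) p) 1 (cmap (X i) q)]].
have nW : nbhs p W by near=> q; split; near: q.
exists W°; split; [exact: open_interior|by []|].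
rewrite (@hmu i) //; last 2 first.
- by apply: open_measurable_borel; exact: open_interior.
- by move=> q /interior_subset[].
apply: (@le_lt_trans _ _ (Num.sqrt M * 2 ^+ d)%:E); last exact: ltry.
rewrite -(@iter_integral_cube R d l 2) //.
apply: le_iter_integral => x; rewrite lee_fin; first by rewrite mulr_ge0 ?sqrtr_ge0.
rewrite [leLHS]mulrC !indicE.
have [/set_mem [q /interior_subset[qM iq bq] <-]|_] := boolP (x \in _); last first.
  by rewrite mulr0 mulr_ge0 ?sqrtr_ge0.
rewrite mulr1 mem_set ?mulr1.
  by rewrite (cmapK (mem_set iq)) ler_wsqrtr // ltW.
move=> j; have [_ /(_ 0 j)] := bq; rewrite mxE /ball /= ltr_norml.
by move=> /andP[]; lra.
Unshelve. all: by end_near. Qed.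

Lemma measure_finite : compact [set: N] -> (mu [set: borel N] < +oo)%E.
Proof.
rewrite compact_cover => cN.
have [A /all_and3[oA Ap finA]] := choice measure_locally_finite.
have [|D _ DN] := cN N [set: N] A (fun p _ => oA p); first by move=> p _; exists p.
have finU (s : seq N) : (mu (\big[setU/set0]_(p <- s) A p : set (borel N)) < +oo)%E.
  elim: s => [|p s IH]; first by rewrite big_nil measure0.
  rewrite big_cons; apply: le_lt_trans (lte_add_pinfty (finA p) IH).
  apply: measureU2; first exact: open_measurable_borel.
  by apply: bigsetU_measurable => q _; exact: open_measurable_borel.
apply: (le_lt_trans _ (finU (finmap.enum_fset D))).
apply: le_measure; rewrite ?inE //.
  by apply: bigsetU_measurable => q _; exact: open_measurable_borel.
move=> q _; have [p pD Apq] := DN q I.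
by rewrite -bigcup_seq; exists p.
Qed.

(** Near [p] the density is bounded away from zero. The image of a neighbourhood
    contains the points of the half-space near the image [x0] of [p], hence a
    cube: one takes [x0] as its lowest corner, to stay in the half-space when
    [p] is a boundary point. *)
Lemma measure_open_gt0 (A : set N) p : open A -> A p -> (0 < mu A)%E.
Proof.
move=> oA Ap.
pose i := chart_at X p; have ip : cdom (X i) p by exact: chart_atP.
pose D := \det (g i p).
have D0 : 0 < D by apply: posdef_det_gt0; exact: riemannian_posdef.
have nD : \forall q \near p, D / 2 < \det (g i q).
  by apply: (cvgr_gt _ (det_C0 ip)); rewrite ltr_pdivrMr // ltr_pMr // ltr1n.
have ni : \forall q \near p, cdom (X i) q.
  by apply: open_nbhs_nbhs; split=> //; exact: cdom_open.
pose W := [set q | [/\ D / 2 < \det (g i q), cdom (X i) q & A q]].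
have nW : nbhs p W.
  have nA : \forall q \near p, A q by exact: open_nbhs_nbhs.
  by near=> q; split; near: q.
have oW : open W° by exact: open_interior.
apply: (@lt_le_trans _ _ (mu W°)); last first.
  apply: le_measure; rewrite ?inE; [exact: open_measurable_borel..|].
  by move=> q /interior_subset[].
rewrite (@hmu i) //; last 2 first.
- exact: open_measurable_borel.
- by move=> q /interior_subset[].
pose x0 := cmap (X i) p.
have x0i : chart_range i x0 by exists p.
have [V oV VE] := @cmap_image _ _ _ (X i).
have x0VH : (V `&` @half_space R d) x0 by rewrite -VE.
have near_x : \forall x \near x0, half_space x -> (cmap (X i) @` W°) x.
  have nV : \forall x \near x0, V x by apply: open_nbhs_nbhs; split => //; case: x0VH.
  have nW' : \forall x \near x0, chart_range i x -> W° (cinv (X i) x).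
    have /subspace_continuousP/(_ x0 x0i) := @cinv_continuous _ _ _ (X i).
    have E : cinv (X i) x0 = p := cmapK (mem_set ip).
    have nW0 : nbhs (cinv (X i) x0) W° by rewrite E; exact: open_nbhs_nbhs.
    by move=> /(_ W° nW0).
  near=> x => Hx.
  have [q iq qx] : chart_range i x by rewrite /chart_range VE; split=> //; near: x.
  exists q => //; rewrite -(cmapK (mem_set iq)) qx.
  have : chart_range i x by exists q.
  by near: x.
have [e /= e0 ex] : exists2 e : R, 0 < e & ball x0 e `<=` [set x | half_space x -> (cmap (X i) @` W°) x].
  by have /nbhs_ballP[e] := near_x; exists e.
apply: (@lt_le_trans _ _ (Num.sqrt (D / 2) * (e / 2) ^+ d)%:E).
  by rewrite lte_fin mulr_gt0 ?exprn_gt0 ?sqrtr_gt0 ?divr_gt0.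
rewrite -(@iter_integral_cube R d x0 (e / 2)) ?sqrtr_ge0 ?divr_ge0 ?(ltW e0) //.
apply: le_iter_integral => x; rewrite lee_fin; first by rewrite mulr_ge0 ?sqrtr_ge0.
rewrite [leRHS]mulrC !indicE.
have [/set_mem xc|_] := boolP (x \in cube _ _); last first.
  by rewrite mulr0 mulr_ge0 ?sqrtr_ge0.
have Wx : (cmap (X i) @` W°) x.
  apply: ex => [|j j0]; last first.
    by have /andP[+ _] := xc j; apply: le_trans; exact: x0VH.2.
  split=> // k j; rewrite (ord1 k) /ball /= ltr_norml.
  by have /andP[] := xc j; lra.
rewrite (mem_set Wx) !mulr1.
case: Wx => q /interior_subset[qD iq _] <-.
by rewrite (cmapK (mem_set iq)) ler_wsqrtr // ltW.
Unshelve. all: by end_near. Qed.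

End Measure.

(** * Integrals over N depending on r *)

Section CompactFamily.
Variables (R : realType) (N : ptopologicalType).
Variable mu : {measure set (borel N) -> \bar R}.
Hypothesis cN : compact [set: N].
Hypothesis muN : (mu [set: borel N] < +oo)%E.
Hypothesis mu_open : forall (A : set N) p, open A -> A p -> (0 < mu A)%E.

Lemma continuous_borel_measurable (f : N -> R) : continuous f ->
  measurable_fun [set: borel N] f.
Proof.
move=> /continuousP cf; apply: (measurability _ (RGenOpens.measurableE R)).
move=> _ [_ [x [y ->] <-]]; rewrite setTI; apply: open_measurable_borel.
exact/cf/interval_open.
Qed.

Lemma integrable_const C : mu.-integrable [set: borel N] (EFin \o cst C).
Proof.
apply/integrableP; split; first exact/measurable_EFinP.
rewrite (eq_integral (cst `|C|%:E)) // integral_cst //.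
by apply: lte_mul_pinfty.
Qed.

Lemma integrable_bounded (f : N -> R) C : continuous f -> (forall p, `|f p| <= C) ->
  mu.-integrable [set: borel N] (EFin \o f).
Proof.
move=> cf fC; apply: (@le_integrable _ _ _ mu _ measurableT _ (EFin \o cst C)).
- by apply/measurable_EFinP; exact: continuous_borel_measurable.
- by move=> p _; rewrite /= lee_fin (le_trans (fC p)) // ler_norm.
- exact: integrable_const.
Qed.

(** A positive value persists on an open set, which has positive measure. *)
Lemma continuous_integral_eq0 (f : N -> R) : continuous f -> (forall p, 0 <= f p) ->
  (\int[mu]_(p in [set: borel N]) (f p)%:E = 0)%E -> forall p, f p = 0.
Proof.
move=> cf f0 If p; apply/eqP; rewrite eq_le f0 andbT leNgt; apply/negP => fp.
pose W := [set q | f p / 2 < f q].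
have oW : open W.
  apply: (@open_comp _ _ f [set x | f p / 2 < x]); last exact: open_gt.
  by move=> q _; exact: cf.
have Wp : W p by rewrite /W /= ltr_pdivrMr // ltr_pMr // ltr1n.
have mW : measurable (W : set (borel N)) by exact: open_measurable_borel.
have : ((f p / 2)%:E * mu W <= 0)%E.
  rewrite -If -[W]setIT -integral_indic // -ge0_integralZl_EFin //; last 2 first.
  - by apply/measurable_EFinP; exact: measurable_indic.
  - by rewrite divr_ge0.
  apply: ge0_le_integral => //.
  - by move=> q _; rewrite -EFinM lee_fin mulr_ge0 // divr_ge0.
  - by apply: measurable_funeM; apply/measurable_EFinP; exact: measurable_indic.
  - by apply/measurable_EFinP; exact: continuous_borel_measurable.
  - move=> q _; rewrite -EFinM lee_fin indicE.
    have [/set_mem Wq|_] := boolP (q \in W); last by rewrite mulr0.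
    by rewrite mulr1 ltW.
apply/negP; rewrite -ltNge; apply: mule_gt0; last exact: mu_open Wp.
by rewrite lte_fin divr_gt0.
Qed.

Variable a : \bar R.
Let U : set (R * N) := [set z | (a < z.1%:E)%E].

Implicit Type phi : R * N -> R.

Lemma C0_slice phi r : C0 U phi -> (a < r%:E)%E -> continuous (fun p => phi (r, p)).
Proof.
move=> Cphi ar p.
apply: (@continuous_comp _ _ _ (fun p => (r, p)) phi); last exact: Cphi.
by apply: (@cvg_pair _ _ _ _ (nbhs r) (nbhs p)); [exact: cvg_cst|exact: cvg_id].
Qed.

Lemma C0_line phi r p : C0 U phi -> (a < r%:E)%E -> continuous_at r (fun r => phi (r, p)).
Proof.
move=> Cphi ar.
apply: (@continuous_comp _ _ _ (fun r => (r, p)) phi); last exact: Cphi.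
by apply: (@cvg_pair _ _ _ _ (nbhs r) (nbhs p)); [exact: cvg_id|exact: cvg_cst].
Qed.

(** A single compactness argument yields the neighbourhood of [r0] and the bound:
    the latter is a second parameter, tending to infinity, so that it suffices to
    have some bound near each point of [N]. *)
Lemma C0_locally_bounded phi r0 : C0 U phi -> (a < r0%:E)%E ->
  exists C u v, (r0 \in `]u, v[) /\ forall r, (r \in `]u, v[) ->
    (a < r%:E)%E /\ forall p, `|phi (r, p)| <= C.
Proof.
move=> Cphi ar.
have /compact_near_coveringP ncN := cN.
have H : \forall rC \near (filter_prod (nbhs r0) (pinfty_nbhs R)), forall p, [set: N] p -> `|phi (rC.1, p)| <= rC.2.
  apply: (ncN _ _ (fun (rC : R * R) p => `|phi (rC.1, p)| <= rC.2)) => p _.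
  pose M := `|phi (r0, p)| + 1.
  have nM : \forall w \near (r0, p), `|phi w| < M.
    by apply: (cvgr_norm_lt _ (Cphi (r0, p) ar)); rewrite ltrDl.
  have [[A B] /= [A0 Bp] AB] := nM.
  exists (B, [set rC | A rC.1 /\ M <= rC.2]).
    split=> //=; exists (A, [set C | M <= C]); last by move=> [].
    by split=> //=; apply: nbhs_pinfty_ge; rewrite num_real.
  by move=> [q [r C]] /= [Bq [Ar MC]]; apply: le_trans MC; apply: ltW; exact: (AB (r, q)).
have H' : \forall r \near r0, (a < r%:E)%E.
  by apply: open_nbhs_nbhs; split=> //; exact: open_above.
have [[A B] /= [A0 BC] AB] := H.
have [C BCC] := filter_ex BC.
have /nbhs_ballP[e /= e0 eA] : \forall r \near r0, A r /\ (a < r%:E)%E.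
  by near=> r; split; near: r.
exists C, (r0 - e), (r0 + e); split.
  by rewrite in_itv /= ltrBlDr !ltrDl e0.
move=> r; rewrite in_itv /= => re; have [|Ar a_r] := eA r.
  by rewrite /ball /= ltr_distlC.
by split=> // p; exact: (AB (r, C)).
Unshelve. all: by end_near. Qed.

Lemma integrable_slice phi r : C0 U phi -> (a < r%:E)%E ->
  mu.-integrable [set: borel N] (EFin \o (fun p => phi (r, p))).
Proof.
move=> Cphi ar; have [C [u [v [ruv uvC]]]] := C0_locally_bounded Cphi ar.
by apply: (@integrable_bounded _ C); [exact: C0_slice|exact: (uvC _ ruv).2].
Qed.

Lemma continuous_integral phi r : C0 U phi -> (a < r%:E)%E ->
  continuous_at r (fun r => \int[mu]_(p in [set: borel N]) phi (r, p)).
Proof.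
move=> Cphi ar; have [C [u [v [ruv uvC]]]] := C0_locally_bounded Cphi ar.
have := @continuity_under_integral R _ (borel N) mu (fun r p => phi (r, p))
  [set: borel N] measurableT u v.
move=> /(_ _ _ (cst C)) H.
apply: H.
- by move=> s /uvC[a_s _]; exact: integrable_slice.
- by apply: aeW => p _ s /set_mem/uvC[a_s _]; exact: C0_line.
- exact: integrable_const.
- by move=> s /uvC[_ sC]; apply: aeW => p _; exact: sC.
- exact/mem_set.
Qed.

Lemma derive_integral phi r : C1 U phi -> (a < r%:E)%E ->
  is_derive r (1 : R) (fun r => \int[mu]_(p in [set: borel N]) phi (r, p))
    (\int[mu]_(p in [set: borel N]) dr phi (r, p)).
Proof.
move=> [dphi C0phi Cdphi] ar.
have [C [u [v [ruv uvC]]]] := C0_locally_bounded Cdphi ar.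
have C0_ p : 0 <= (cst C : borel N -> R) p by exact: le_trans ((uvC _ ruv).2 p).
have intf s : `]u, v[%classic s -> mu.-integrable [set: borel N] (EFin \o (fun p => phi (s, p))).
  by move=> /uvC[a_s _]; exact: integrable_slice.
have der (s : R) p : `]u, v[%classic s -> [set: borel N] p -> derivable (fun s => phi (s, p)) s 1.
  by move=> /uvC[a_s _] _; exact: (dphi (s, p)).
have bnd (s : R) p : `]u, v[%classic s -> [set: borel N] p ->
    `|partial1of2 (fun s p => phi (s, p)) s p| <= cst C p.
  by move=> /uvC[a_s sC] _; exact: sC.
have intC : mu.-integrable [set: borel N] (EFin \o cst C) by exact: integrable_const.
have := @derivable_under_integral R _ (borel N) mu (fun s p => phi (s, p)) _
  measurableT r u v ruv intf der (cst C) C0_ intC bnd.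
have := @differentiation_under_integral R _ (borel N) mu (fun s p => phi (s, p)) _
  measurableT r u v ruv intf der (cst C) C0_ intC bnd.
rewrite derive1E => D1 D2.
by apply: DeriveDef => //; rewrite D1.
Qed.

End CompactFamily.

(** * Monotone functions with limits at both ends *)

Section DeriveSign.
Variables (R : realType) (a : \bar R).
Let D : set R := [set r | (a < r%:E)%E].

Lemma derive_mono (P P' : R -> R) s t : (forall r, D r -> is_derive r (1 : R) P (P' r)) ->
  (forall r, D r -> 0 <= P' r) -> D s -> s <= t -> P s <= P t.
Proof.
move=> dP P'0 Ds st.
have Dt x : s <= x -> D x by move=> sx; apply: (lt_le_trans Ds); rewrite lee_fin.
apply: (@ger0_derive1_ndecry R P s) => // [x|x|].
- by rewrite in_itv /= andbT => /ltW /Dt /dP[].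
- by rewrite in_itv /= andbT => /ltW /Dt Dx; have ? := dP x Dx; rewrite derive1E derive_val P'0.
- apply: derivable_within_continuous => x; rewrite in_itv /= andbT => /Dt Dx.
  by have [] := dP x Dx.
Qed.

Lemma derive0_cst (P : R -> R) s t : (forall r, D r -> is_derive r (1 : R) P 0) ->
  D s -> D t -> P s = P t.
Proof.
wlog st : s t / s <= t.
  move=> H dP Ds Dt; have /orP[st|ts] := le_total s t; first exact: H.
  by symmetry; exact: H.
move=> dP Ds _; apply/eqP; rewrite eq_le.
rewrite (@derive_mono P (fun=> 0)) //= -lerN2.
apply: (@derive_mono (- P) (fun=> 0)) => // r Dr; rewrite -oppr0.
exact/is_deriveN/dP.
Qed.

End DeriveSign.

Section MonotoneDefect.
Variables (R : realType) (a : \bar R).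
Hypothesis a_lty : (a < +oo)%E.
Local Notation lambda := (@lebesgue_measure R).
Let D : set R := [set r | (a < r%:E)%E].

Let lb : itv_bound R := match a with x%:E => BRight x | _ => BInfty _ true end.

Let lb_set w : [set` Interval lb (BRight w)] = D `&` [set y | y <= w].
Proof.
rewrite /lb /D; case: a a_lty => [x| |] //= _; apply/seteqP; split=> y /=;
  rewrite in_itv /= ?lte_fin ?ltNyr //.
- by move=> /andP.
- by move=> [-> ->].
- by case.
Qed.

Lemma above_measurable : measurable D.
Proof. by apply: open_measurable; exact: open_above. Qed.

Variable F : R -> R.
Hypothesis intF : lambda.-integrable D (EFin \o F).
Let J w := \int[lambda]_(y in [set` Interval lb (BRight w)]) F y.

(** Dominated convergence; for [b = true] the levels [w n] exhaust the half-line,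
    for [b = false] they tend to its left end. *)
Lemma cvg_truncation (b : bool) (w : R^nat) :
  (forall y, D y -> \forall n \near \oo, (y <= w n) = b) ->
  J (w n) @[n --> \oo] --> if b then \int[lambda]_(y in D) F y else 0.
Proof.
move=> wb.
have mD := above_measurable.
have mle v : measurable [set y : R | y <= v].
  by rewrite -set_itvNyc; exact: measurable_itv.
have JE v : (\int[lambda]_(y in [set` Interval lb (BRight v)]) (F y)%:E)%E =
    (\int[lambda]_(y in D) (((EFin \o F) \_ [set y | (y <= v)%R]) y))%E.
  by rewrite lb_set integral_mkcondr.
pose l y := if b then (F y)%:E else 0%E.
have mF : measurable_fun D (EFin \o F) by case/integrableP: intF.
have [|||||_ _] := @dominated_convergence _ _ _ lambda D mD
  (fun n => (EFin \o F) \_ [set y | y <= w n]) l (abse \o (EFin \o F)).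
- move=> n; apply/measurable_restrict => //; first exact: mle.
  by apply: (measurable_funS mD _ mF) => y [].
- by rewrite /l; case: (b).
- apply: aeW => y Dy; apply: cvg_near_cst.
  apply: filterS (wb y Dy) => n wn; rewrite patchE /l -wn.
  by case: ifPn => [/set_mem /= ->|/negP nw] //; case: ifP => // yw; case: nw; exact/mem_set.
- exact: integrable_abse.
- apply: aeW => y n Dy; rewrite patchE; case: ifP => // _; by rewrite abse0 abse_ge0.
move=> H.
have -> : (if b then \int[lambda]_(y in D) F y else 0) = fine (\int[lambda]_(y in D) l y)%E.
  by rewrite /l; case: (b) => //; rewrite integral0.
apply: fine_cvg.
have fin : (\int[lambda]_(y in D) l y)%E \is a fin_num.
  rewrite /l; case: (b); first exact: integrable_fin_num.
  by rewrite integral0.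
rewrite fineK //.
apply: cvg_trans H; apply: near_eq_cvg; apply: nearW => n.
by rewrite /= JE.
Qed.

Variables (M Q : R -> R) (Ma Minf : R).
Hypothesis Q0 : forall r, D r -> 0 <= Q r.
Hypothesis cF : forall r, D r -> continuous_at r F.
Hypothesis dM : forall r, D r -> is_derive r (1 : R) M (F r + Q r).
Hypothesis hMa : M r @[r --> approach a a] --> Ma.
Hypothesis hMinf : M r @[r --> approach a +oo%E] --> Minf.

Let Phi r := M r - J r.

Let dPhi r : D r -> is_derive r (1 : R) Phi (Q r).
Proof.
move=> Dr; have -> : Q r = (F r + Q r) - F r by rewrite addrAC subrr add0r.
have iF : lambda.-integrable [set` Interval lb (BRight (r + 1))] (EFin \o F).
  apply: (integrableS _ _ _ intF); [exact: above_measurable|exact: measurable_itv|].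
  by rewrite lb_set => y [].
have [|||dJ J'] := @continuous_FTC1 R F lb r (r + 1) _ iF.
- by rewrite ltrDl.
- by move: Dr; rewrite /D /lb /=; case: a a_lty => [x| |] // _; rewrite bnd_simp lte_fin.
- exact: cF.
apply: is_deriveB; first exact: dM.
by apply: DeriveDef => //; rewrite -derive1E J'.
Qed.

(* The sequences u and v tend to the two ends of the half-line. *)
Let c : R := match a with x%:E => x + 1 | _ => 0 end.
Let u n : R := match a with x%:E => x + n.+1%:R^-1 | _ => - n%:R end.
Let v n : R := c + n%:R.

Let u_above n : D (u n).
Proof.
by rewrite /D /u /=; case: a a_lty => [x| |] //= _; rewrite ?ltNyr // lte_fin ltrDl invr_gt0.
Qed.

Let v_above n : D (v n).
Proof.
rewrite /D /v /c /=; case: a a_lty => [x| |] //= _; rewrite ?ltNyr // lte_fin.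
by rewrite -addrA ltrDl ltr_pwDl.
Qed.

Let u_cvg : u @ \oo --> approach a a.
Proof.
move=> A; rewrite /approach /= => wA.
suff H : \forall n \near \oo, D (u n) -> A (u n) by apply: filterS H => n; apply; exact: u_above.
move: wA; rewrite /u /D; case: a a_lty => [x| |] //= _ wA.
  have cx : x + n.+1%:R^-1 @[n --> \oo] --> x.
    by rewrite -[X in _ --> X]addr0; apply: cvgD; [exact: cvg_cst|exact: cvg_harmonic].
  exact: (cx _ wA).
have cx : - (n%:R : R) @[n --> \oo] --> -oo.
  apply/cvgrNyPle => B; have /cvgryPge/(_ (- B)) := @cvgr_idn R.
  by apply: filterS => n; rewrite lerNl.
exact: (cx _ wA).
Qed.

Let v_cvg : v @ \oo --> +oo.
Proof.
apply/cvgryPge => A; have /cvgryPge/(_ (A - c)) := @cvgr_idn R.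
by apply: filterS => n; rewrite /v lerBlDl.
Qed.

Let v_cvg' : v @ \oo --> approach a +oo%E.
Proof.
move=> A; rewrite /approach /= => wA.
suff H : \forall n \near \oo, D (v n) -> A (v n) by apply: filterS H => n; apply; exact: v_above.
exact: (v_cvg wA).
Qed.

Let approach_filter : Filter (approach a a).
Proof. by rewrite /approach; case: a => [x| |]; exact: within_filter. Qed.

Let approach_lt y : D y -> \forall r \near approach a a, r < y.
Proof.
rewrite /D /approach /=; case: a a_lty => [x| |] //= _ xy.
  exact: cvg_within (lt_nbhsl xy).
by apply: cvg_within; apply: nbhs_ninfty_lt; rewrite num_real.
Qed.

Let Phi_u : Phi (u n) @[n --> \oo] --> Ma.
Proof.
rewrite -[Ma]subr0; apply: cvgB; first exact: (cvg_comp _ _ u_cvg hMa).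
apply: (@cvg_truncation false) => y Dy.
have H := approach_lt Dy.
have H' : \forall r \near approach a a, (y <= r) = false.
  by apply: (@filterS _ _ approach_filter _ _ _ H) => r; rewrite ltNge => /negbTE.
exact: (u_cvg H').
Qed.

Let Phi_v : Phi (v n) @[n --> \oo] --> Minf - \int[lambda]_(y in D) F y.
Proof.
apply: cvgB; first exact: (cvg_comp _ _ v_cvg' hMinf).
apply: (@cvg_truncation true) => y Dy.
by move: v_cvg => /cvgryPge /(_ y).
Qed.

Let Phi_mono s t : D s -> s <= t -> Phi s <= Phi t.
Proof. exact: (derive_mono dPhi Q0). Qed.

Let Phi_ge r : D r -> Ma <= Phi r.
Proof.
move=> Dr; apply: (cvgr_to_le Phi_u).
have H : \forall n \near \oo, u n < r := u_cvg (approach_lt Dr).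
by apply: filterS H => n /ltW; exact: Phi_mono.
Qed.

Let Phi_le r : D r -> Phi r <= Minf - \int[lambda]_(y in D) F y.
Proof.
move=> Dr; apply: (cvgr_to_ge Phi_v).
by move: v_cvg => /cvgryPge /(_ r); apply: filterS => n; exact: Phi_mono.
Qed.

(** The function [Phi r = M r - int_(a, r] F] has derivative [Q >= 0] and limits
    [Ma] at [a] and [Minf - int F] at infinity. So it is nondecreasing, its
    limits are ordered, and they coincide exactly when it is constant. *)
Lemma monotone_defect :
  \int[lambda]_(y in D) F y <= Minf - Ma /\
  (Minf - Ma = \int[lambda]_(y in D) F y <-> forall r, D r -> Q r = 0).
Proof.
set I := \int[lambda]_(y in D) F y.
have Dv := v_above 0.
have ge := Phi_ge Dv; have le := Phi_le Dv.
split; first by move: (le_trans ge le); rewrite -/I; lra.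
split=> [E r Dr|Q_0].
  have Phi_cst s : D s -> Phi s = Ma.
    move=> Ds; apply/eqP; rewrite eq_le Phi_ge // andbT.
    by have := Phi_le Ds; rewrite -/I -E; lra.
  have := dPhi Dr => d1.
  have d2 : is_derive r (1 : R) Phi 0.
    apply: near_eq_is_derive (is_derive_cst Ma r 1).
    have nD : \forall s \near r, D s by apply: open_nbhs_nbhs; split=> //; exact: open_above.
    by apply: filterS nD => s /Phi_cst.
  by rewrite -[LHS](@derive_val _ _ _ _ _ _ _ d1) derive_val.
have Phi_c r : D r -> Phi r = Phi (v 0).
  move=> Dr; apply: (@derive0_cst _ a) => // x Dx.
  by rewrite -(Q_0 _ Dx); exact: dPhi.
have cst_cvg (w : R^nat) : (forall n, D (w n)) -> Phi (w n) @[n --> \oo] --> Phi (v 0).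
  move=> Dw; have -> : (fun n => Phi (w n)) = cst (Phi (v 0)).
    by apply/funext => n; exact: Phi_c.
  exact: cvg_cst.
have -> : Ma = Phi (v 0) := cvg_unique (@Rhausdorff R) Phi_u (cst_cvg _ u_above).
have : Minf - I = Phi (v 0) := cvg_unique (@Rhausdorff R) Phi_v (cst_cvg _ v_above).
by move=> <-; lra.
Qed.

End MonotoneDefect.

(** * The equality case *)

Section Profile.
Variables (R : realType) (k : R) (a : \bar R).
Hypothesis ha : left_end k a.

Lemma left_end_lty : (a < +oo)%E.
Proof. by case: ha => [[x _ ->]|[_ ->]]; rewrite ?ltry. Qed.

(** The factor [e^(2 r) + k] of [h] is increasing in [r]; for [k < 0] it vanishes
    at [ln (- k) / 2]. *)
Lemma hring_gt0 r : (a < r%:E)%E -> 0 < hring k r.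
Proof.
have hE x : hring k x = (expR (x *+ 2) + k) * expR (- x).
  by rewrite /hring mulrDl mulr2n -expRD addrK.
rewrite hE pmulr_lgt0 ?expR_gt0 //.
case: ha => [[x x0 ->]|[h0 ->]].
  rewrite lte_fin => xr.
  have -> : k = - expR (x *+ 2).
    apply/eqP; rewrite -addr_eq0 addrC; move/eqP: x0; rewrite hE mulf_eq0.
    by rewrite (gt_eqF (expR_gt0 _)) orbF.
  by rewrite subr_gt0 ltr_expR ltrMn2r.
move=> _; rewrite ltNge; apply/negP => k0.
have kn : 0 < - k.
  by rewrite oppr_gt0; apply: lt_le_trans k0; rewrite ltrDr expR_gt0.
have /negP := h0 (ln (- k) / 2); apply.
have -> : hring k (ln (- k) / 2) = (expR (ln (- k)) + k) * expR (- (ln (- k) / 2)).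
  by rewrite hE -[_ *+ 2]mulr_natr divfK ?pnatr_eq0.
by rewrite lnK ?posrE // addNr mul0r.
Qed.

End Profile.

Lemma smooth_onZ (R : realType) m (S : set 'rV[R]_m) (c : R) f :
  smooth_on S f -> smooth_on S (fun x => c * f x).
Proof.
move=> Sf x /Sf[V [F [oV Vx CF VF]]].
exists V, (fun x => c * F x); split=> //; last by move=> y /VF ->.
have E (s : seq 'I_m) : {in V, iter_partial (fun x => c * F x) s =1 (fun x => c * iter_partial F s x)}.
  elim: s => [|i s IH] y /set_mem Vy //=.
  have [_ /(_ i) dF] := CF s y Vy.
  rewrite -[RHS](deriveZ _ dF); apply: near_eq_derive.
  by apply: filterS (open_nbhs_nbhs (conj oV Vy)) => w /mem_set /IH.
move=> s y Vy; have [cF dF] := CF s y Vy.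
have nE : \forall w \near y, c * iter_partial F s w = iter_partial (fun x => c * F x) s w.
  by apply: filterS (open_nbhs_nbhs (conj oV Vy)) => w /mem_set /E.
split.
  suff : continuous_at y (iter_partial (fun x => c * F x) s) by [].
  rewrite /continuous_at -(nbhs_singleton nE).
  have cc : c * iter_partial F s w @[w --> y] --> c * iter_partial F s y.
    exact: (cvgM (cvg_cst c) cF).
  exact: (cvg_trans (near_eq_cvg nE) cc).
move=> i; apply: near_eq_derivable nE _.
by have := @derivableZ _ _ _ (iter_partial F s) c _ _ (dF i).
Qed.

Section Rigidity.
Variables (R : realType) (d : nat) (N : ptopologicalType).
Variables (X : smooth_manifold R d N) (a : \bar R) (G : R -> tensor X) (k : R).
Hypothesis hG : metric_family a G.
Hypothesis ha : left_end k a.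
Let U : set (R * N) := [set z | (a < z.1%:E)%E].
Let h := hring k.
Let h' := hring (- k).

Let oU : open U := @open_slab R N a.

Lemma exists_above : exists r : R, (a < r%:E)%E.
Proof.
by case: ha => [[x _ ->]|[_ ->]]; [exists (x + 1); rewrite lte_fin ltrDl|exists 0; rewrite ltNyr].
Qed.

Lemma riemannian_scale (g : tensor X) c : 0 < c -> riemannian_metric g ->
  riemannian_metric (fun i p => c *: g i p).
Proof.
move=> c0 hg; split.
- by move=> i j p ip jp; rewrite (metric_compat hg ip jp) -scalemxAr -scalemxAl.
- by move=> i p ip; rewrite linearZ /= (Defs.metric_sym hg ip).
- move=> i p v ip v0; rewrite -scalemxAr -scalemxAl mxE mulr_gt0 //.
  exact: (metric_pos hg).
- move=> i b c'; have := smooth_onZ c (Defs.metric_smooth hg (i := i) b c').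
  by congr smooth_on; apply/funext => x; rewrite mxE.
Qed.

(** When the defect vanishes, [h G' = 2 h' G], that is [(G / h^2)' = 0]. *)
Lemma warped_of_defect0 : (forall z, U z -> defect G k z = 0) ->
  exists2 Gt : tensor X, riemannian_metric Gt &
    forall r, (a < r%:E)%E -> tensor_eq (G r) (warped h Gt r).
Proof.
move=> q0; have [r0 ar0] := exists_above.
have h0 r : (a < r%:E)%E -> h r != 0 by move=> /(hring_gt0 ha)/gt_eqF/negbT.
(* G / h^2 is constant in r, so any level r0 will do. *)
exists (fun i p => (h r0 * h r0)^-1 *: G r0 i p).
  apply: riemannian_scale; last exact: hG.1.
  by rewrite invr_gt0 mulr_gt0 // (hring_gt0 ha).
move=> r ar i p ip; apply/matrixP => b c.
pose P s := (h s * h s)^-1 * G s i p b c.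
have dP s : (a < s%:E)%E -> is_derive s (1 : R) P 0.
  move=> as_.
  have Uis : cyl a i (s, p) by [].
  have /matrixP/(_ b c) := defect_eq0 hG (i := i) (as_ : U (s, p)) ip (q0 (s, p) as_).
  rewrite !mxE /= => dG.
  have dh := is_derive_hring k s.
  have dg : is_derive s (1 : R) (fun s => G s i p b c)
      (derive1 (fun s => G s i p b c) s).
    have [[dG' _ _] _] := metric_C1 hG i b c.
    by rewrite derive1E; apply/derivableP/(dG' (s, p) Uis).
  have dhh : is_derive s (1 : R) (h * h) (h s *: h' s + h s *: h' s) by exact: is_deriveM.
  have hs0 := h0 s as_.
  have hhs0 : (h * h) s != 0 by rewrite mulf_neq0.
  have dinv : is_derive s (1 : R) (fun s => ((h * h) s)^-1)
      (- ((h * h) s) ^- 2 *: (h s *: h' s + h s *: h' s)).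
    have [dhh' _] := dhh.
    apply: DeriveDef; first exact: (@derivableV _ _ (h * h)).
    by rewrite (@deriveV _ _ (h * h)) // derive_val.
  have := @is_deriveM R _ _ _ s 1 _ _ dinv dg.
  set g' := derive1 _ s in dG *.
  have -> : g' = 2 * h' s * G s i p b c / h s by rewrite -dG mulrAC mulfV // mul1r.
  have E x y : (h * h) s = h s * h s -> ((h * h) s)^-1 *: (2 * y * x / h s) +
      x *: (- ((h * h) s) ^- 2 *: (h s *: y + h s *: y)) = 0.
    by move=> ->; rewrite /GRing.scale /=; field.
  by rewrite E.
have := derive0_cst (a := a) dP ar ar0.
rewrite /P !mxE => E.
have hh : h r * h r != 0 by rewrite mulf_neq0 // h0.
by rewrite -E mulrA expr2 mulfV // mul1r.
Qed.

Lemma defect0_of_warped (Gt : tensor X) :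
  (forall r, (a < r%:E)%E -> tensor_eq (G r) (warped h Gt r)) ->
  forall z, U z -> defect G k z = 0.
Proof.
move=> GE [r p] Uz; apply: (defect_conformal0 Uz) => /=.
set i := chart_at X p; have ip : cdom (X i) p by exact: chart_atP.
rewrite (GE r Uz i p ip) /warped.
have -> : radial_mx G i (r, p) = (2 * h r * h' r) *: Gt i p.
  apply/matrixP => b c; rewrite !mxE /= derive1E.
  have nE : \forall s \near r, (Gt i p b c *: (h * h)) s = G s i p b c.
    apply: filterS (near_slice oU Uz) => s as_.
    transitivity (Gt i p b c * (h s * h s)); first by [].
    by rewrite (GE s as_ i p ip) /warped mxE -/h expr2 mulrC.
  rewrite -(near_eq_derive _ nE).
  have dh := is_derive_hring k r.
  have dhh : is_derive r (1 : R) (h * h) (h r *: h' r + h r *: h' r) by exact: is_deriveM.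
  rewrite derive_val /GRing.scale /=; ring.
rewrite !scalerA; congr (_ *: _); rewrite -/h -/h' expr2; ring.
Qed.

Lemma approach_ex r0 (A : set R) : (a <= r0)%E ->
  (\forall r \near approach a r0, A r) -> exists2 r : R, (a < r%:E)%E & A r.
Proof.
case: r0 => [x| |] ar0.
- move=> /nbhs_ballP[e /= e0 eA].
  have ax : (a < (x + e / 2)%:E)%E.
    by apply: (le_lt_trans ar0); rewrite lte_fin ltrDl divr_gt0.
  exists (x + e / 2) => //; apply: eA => //.
  by rewrite /ball /= opprD addrA subrr sub0r normrN gtr0_norm ?divr_gt0 //; lra.
- move=> [B [_ BA]]; have [r1 ar1] := exists_above.
  have ar : (a < (Num.max r1 (B + 1))%:E)%E.
    by apply: (lt_le_trans ar1); rewrite lee_fin le_max lexx.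
  by exists (Num.max r1 (B + 1)) => //; apply: BA => //; rewrite lt_max ltrDl ltr01 orbT.
- move=> [B [_ BA]]; have aNy : a = -oo%E by apply/eqP; rewrite -leeNy_eq.
  have ar : (a < (B - 1)%:E)%E by rewrite aNy ltNyr.
  by exists (B - 1) => //; apply: BA => //; rewrite ltrBlDr ltrDl.
Qed.

(** The norm of a covariant 2-tensor is invariant when the metric and the tensor
    are multiplied by the same factor. *)
Lemma tensor_norm_warped (Ghat T : tensor X) c p : riemannian_metric Ghat -> c != 0 ->
  tensor_norm (fun i p => c *: Ghat i p) (fun i p => c *: T i p) p =
  Num.sqrt (sqnorm (Ghat (chart_at X p) p) (T (chart_at X p) p)).
Proof.
move=> hg c0; rewrite /tensor_norm /sqnorm; congr Num.sqrt.
set i := chart_at X p.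
have -> : invmx (c *: Ghat i p) = c^-1 *: invmx (Ghat i p).
  have Au : Ghat i p \in unitmx.
    by apply: posdef_unit; apply: riemannian_posdef => //; exact: chart_atP.
  apply: invmx_unique; first by rewrite unitmxZ ?unitfE.
  by rewrite -scalemxAl -scalemxAr scalerA mulfV // scale1r mulmxV.
have cT (A B : 'M[R]_d) : (c^-1 *: A) *m (c *: B) = A *m B.
  by rewrite -scalemxAl -scalemxAr scalerA mulVf // scale1r.
have -> : (c *: T i p)^T = c *: (T i p)^T by rewrite linearZ.
by rewrite cT -!mulmxA cT.
Qed.

(** For [G = h^2 Gt] the norm of [G - h^2 Ghat] with respect to [h^2 Ghat] is the
    norm of [Gt - Ghat] with respect to [Ghat]. It does not depend on [r], and it
    is smaller than every [e > 0]. *)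
Lemma asymptotic_unique (Ghat Gt : tensor X) r0 : (a <= r0)%E ->
  riemannian_metric Ghat -> riemannian_metric Gt ->
  (forall r, (a < r%:E)%E -> tensor_eq (G r) (warped h Gt r)) ->
  asymptotic_at a r0 h Ghat G -> tensor_eq Gt Ghat.
Proof.
move=> ar0 hgh hgt GE asym.
have E p : Gt (chart_at X p) p = Ghat (chart_at X p) p.
  set i := chart_at X p; have ip : cdom (X i) p by exact: chart_atP.
  have pd := riemannian_posdef hgh ip.
  apply/eqP; rewrite -subr_eq0; apply/eqP; apply: (sqnorm_eq0 pd).
  apply/eqP; rewrite eq_le sqnorm_ge0 // andbT leNgt; apply/negP => s0.
  have sq0 : 0 < Num.sqrt (sqnorm (Ghat i p) (Gt i p - Ghat i p)) by rewrite sqrtr_gt0.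
  have [r ar /(_ p)] := approach_ex ar0 (asym _ sq0).
  have hr : h r ^+ 2 != 0 by rewrite expf_neq0 // gt_eqF // (hring_gt0 ha).
  suff -> : tensor_norm (warped h Ghat r) (tensor_sub (G r) (warped h Ghat r)) p =
      Num.sqrt (sqnorm (Ghat i p) (Gt i p - Ghat i p)) by rewrite ltxx.
  rewrite -(tensor_norm_warped (fun i p => Gt i p - Ghat i p) p hgh hr).
  rewrite /tensor_norm /tensor_sub /= (GE r ar i p ip) /warped -/i.
  by rewrite scalerBr.
move=> i p ip; have jp := chart_atP X p.
by rewrite (metric_compat hgt ip jp) (metric_compat hgh ip jp) E.
Qed.

Lemma cyl_metric_eqP (Ghat : tensor X) :
  cyl_metric_eq a G (warped h Ghat) <->
  forall r, (a < r%:E)%E -> tensor_eq (G r) (warped h Ghat r).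
Proof.
split=> [E r ar i p ip|E i z Sz].
  have Uz : cyl a i (r, p) by [].
  have := E i _ (iota_cyl_range Uz).
  rewrite (cyl_metricE _ Uz).
  have /= -> := cyl_metricE (warped h Ghat) Uz.
  by move=> /eq_block_mx[_ _ _].
have [w Uw ->] := cyl_rangeP Sz.
rewrite (cyl_metricE _ Uw).
have /= -> := cyl_metricE (warped h Ghat) Uw.
by congr block_mx; exact: E Uw.1 _ _ Uw.2.
Qed.

End Rigidity.

(** * Monotonicity of the relative radial mass *)

Section Reduction.
Variables (R : realType) (d : nat) (N : ptopologicalType).
Variables (X : smooth_manifold R d N) (a : \bar R) (G : R -> tensor X) (k : R).
Variable Ghat : tensor X.
Variable mu : {sigma_finite_measure set (borel N) -> \bar R}.
Hypothesis cN : compact [set: N].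
Hypothesis hGhat : riemannian_metric Ghat.
Hypothesis hmu : riemannian_measure Ghat mu.
Hypothesis ha : left_end k a.
Hypothesis hG : metric_family a G.
Let D : set R := [set r | (a < r%:E)%E].
Let DN : set (R * borel N) := [set z | (a < z.1%:E)%E].
Let U : set (R * N) := [set z | (a < z.1%:E)%E].
Let muN := measure_finite hGhat hmu cN.
Let mu_open := measure_open_gt0 hGhat hmu.
Local Notation lambda := (@lebesgue_measure R).

Let F r := \int[mu]_(p in [set: borel N]) ricci_density a G k (r, p).
Let Q r := \int[mu]_(p in [set: borel N]) defect G k (r, p).

Let oU : open U := @open_slab R N a.

Lemma defect_C0 : C0 U (defect G k).
Proof.
have CC := @C0_class R _ _ oU.
have [_ _ dm] := mass_density_C1 hG k.
apply: (class_eq CC (f := fun z => dr (mass_density G k) z - ricci_density a G k z)).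
  by move=> z Uz; rewrite (dr_mass_density hG) // addrAC subrr add0r.
by apply: (class_sub CC) => //; exact: ricci_density_C0.
Qed.

Lemma radial_massE r : D r -> radial_mass mu (hring k) G r =
  \int[mu]_(p in [set: borel N]) mass_density G k (r, p).
Proof.
move=> Dr; apply: eq_Rintegral => p _.
have h0 : hring k r != 0 by rewrite gt_eqF // (hring_gt0 ha).
have dh := is_derive_hring k r.
rewrite /mean_curvature0 derive1E derive_val /mass_density /=.
rewrite -[mean_curvature G r p]/(mean_curv G (r, p)).
by field.
Qed.

Lemma derive_radial_mass r : D r ->
  is_derive r (1 : R) (radial_mass mu (hring k) G) (F r + Q r).
Proof.
move=> Dr.
have := derive_integral cN muN (mass_density_C1 hG k) Dr.
have -> : \int[mu]_(p in [set: borel N]) dr (mass_density G k) (r, p) = F r + Q r.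
  rewrite -RintegralD //; last 2 first.
  - by apply: (integrable_slice cN muN _ Dr); exact: ricci_density_C0.
  - by apply: (integrable_slice cN muN _ Dr); exact: defect_C0.
  by apply: eq_Rintegral => p _; exact: (dr_mass_density hG).
apply: near_eq_is_derive.
have nD : \forall s \near r, D s by apply: open_nbhs_nbhs; split=> //; exact: open_above.
by apply: filterS nD => s Ds; rewrite radial_massE.
Qed.

Lemma total_defect_eq0 : (forall r, D r -> Q r = 0) <->
  (forall z, U z -> defect G k z = 0).
Proof.
split=> [Q0 [r p] Uz|q0 r Dr]; last first.
  by rewrite /Q /Rintegral integral0_eq // => p _; rewrite q0.
apply: (continuous_integral_eq0 mu_open (f := fun p => defect G k (r, p))).
- exact: (C0_slice defect_C0 Uz).
- by move=> q; exact: (defect_ge0 hG).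
- have int := integrable_slice cN muN defect_C0 Uz.
  by rewrite -(fineK (integrable_fin_num measurableT int)); congr (_%:E); exact: Q0.
Qed.

Hypothesis hint : (lambda \x mu)%E.-integrable DN
  (fun z => (ricci_density a G k z)%:E).

Let mDN : measurable DN.
Proof.
rewrite (_ : DN = D `*` [set: borel N]).
  by apply: measurableX => //; exact: above_measurable.
by apply/seteqP; split=> [z|z []].
Qed.

Let f0 : R * borel N -> \bar R := (fun z => (ricci_density a G k z)%:E) \_ DN.
Let f0_int : (lambda \x mu)%E.-integrable setT f0.
Proof. exact: (@integrable_mkcond _ _ _ (lambda \x mu)%E DN _ mDN).1 hint. Qed.

Let fubiniE : fubini_F mu f0 = (EFin \o F) \_ D.
Proof.
apply/funext => r; rewrite /fubini_F /f0 patchE.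
case: ifPn => [/set_mem Dr|nDr].
  rewrite /= /F /Rintegral fineK.
    by apply: eq_integral => p _; rewrite patchE mem_set.
  apply: integrable_fin_num => //.
  by apply: (integrable_slice cN muN _ Dr); exact: ricci_density_C0.
rewrite -[RHS](integral0 mu [set: borel N]); apply: eq_integral => p _.
by rewrite patchE; case: ifPn => // /set_mem Dr; case/negP: nDr; exact/mem_set.
Qed.

Lemma integrable_fiber_integral : lambda.-integrable D (EFin \o F).
Proof.
apply/integrable_mkcond; first exact: above_measurable.
by rewrite -fubiniE; exact: integrable_fubini_F.
Qed.

Lemma fiber_integral :
  \int[(lambda \x mu)%E]_(z in DN) ricci_density a G k z =
  \int[lambda]_(r in D) F r.
Proof.
rewrite /Rintegral; congr fine.
rewrite integral_mkcond -/f0 [RHS]integral_mkcond.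
by rewrite -[(EFin \o F) \_ D]fubiniE; symmetry; exact: integral12_prod_meas1.
Qed.

(** Differentiation under the integral sign turns [dr_mass_density] into
    [M' = F + Q], and Fubini's theorem identifies the integral of [F] with the
    integral over the cylinder. *)
Lemma mass_monotone (Ma Minf : R) :
  radial_mass mu (hring k) G r @[r --> approach a a] --> Ma ->
  radial_mass mu (hring k) G r @[r --> approach a +oo%E] --> Minf ->
  let I := \int[(lambda \x mu)%E]_(z in DN) ricci_density a G k z in
  I <= Minf - Ma /\ (Minf - Ma = I <-> forall z, U z -> defect G k z = 0).
Proof.
move=> hMa hMinf; rewrite /= fiber_integral.
rewrite -total_defect_eq0.
apply: (monotone_defect (left_end_lty ha) integrable_fiber_integral _ _ _ hMa hMinf).
- move=> r Dr; apply: Rintegral_ge0 => p _; exact: (defect_ge0 hG).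
- by move=> r Dr; apply: (continuous_integral cN muN _ Dr); exact: ricci_density_C0.
- exact: derive_radial_mass.
Qed.

End Reduction.

Unset Implicit Arguments.

Theorem corollary5p1 (R : realType) (n : nat) (hn : (2 <= n)%N)
  (N : ptopologicalType) (X : smooth_manifold R n.-1 N)
  (hN : compact [set: N])
  (Ghat : tensor X) (hGhat : riemannian_metric Ghat)
  (mu : {sigma_finite_measure set (borel N) -> \bar R})
  (hmu : riemannian_measure Ghat mu)
  (k : R) (a : \bar R) (ha : left_end k a)
  (G : R -> tensor X) (hG : metric_family a G)
  (Ma Minf : R)
  (hMa : radial_mass mu (hring k) G r @[r --> approach a a] --> Ma)
  (hMinf : radial_mass mu (hring k) G r @[r --> approach a +oo%E] --> Minf)
  (hint : (@lebesgue_measure R \x mu)%E.-integrable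
     [set z : R * borel N | (a < z.1%:E)%E]
     (fun z => (hring k z.1 ^+ 2 *
                  (ricci_rr a G z.1 z.2 + (n%:R - 1)))%:E)) :
  let I := \int[(@lebesgue_measure R \x mu)%E]_(z in
             [set z : R * borel N | (a < z.1%:E)%E])
             (hring k z.1 ^+ 2 * (ricci_rr a G z.1 z.2 + (n%:R - 1))) in
  [/\ Minf - Ma >= I,
      Minf - Ma = I <->
        (exists2 Gt : tensor X, riemannian_metric Gt &
           forall r, (a < r%:E)%E -> tensor_eq (G r) (warped (hring k) Gt r)) &
      forall r0 : \bar R, (a <= r0)%E ->
        asymptotic_at a r0 (hring k) Ghat G ->
        (Minf - Ma = I <-> cyl_metric_eq a G (warped (hring k) Ghat))].
Proof.
have nE : n%:R - 1 = n.-1%:R :> R.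
  by rewrite -[in LHS](ltn_predK hn) -natr1 addrK.
rewrite nE in hint *.
move=> I.
have [ge eq] := mass_monotone hN hGhat hmu ha hG hint hMa hMinf.
rewrite -/I in ge eq.
have warpedP : Minf - Ma = I <->
        (exists2 Gt : tensor X, riemannian_metric Gt &
           forall r, (a < r%:E)%E -> tensor_eq (G r) (warped (hring k) Gt r)).
  rewrite eq; split; first exact: warped_of_defect0.
  by move=> [Gt _ GE]; exact: defect0_of_warped GE.
split=> // r0 ar0 asym; rewrite cyl_metric_eqP warpedP; split.
  move=> [Gt hGt GE]; have E := asymptotic_unique ha ar0 hGhat hGt GE asym.
  by move=> r ar i p ip; rewrite (GE r ar i p ip) /warped (E i p ip).
by move=> GE; exists Ghat.
Qed.
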